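(* Let $p$ be a prime, let $G$ be a finite $p$-group, let $\mathbb{F}_p$ be the field with $p$ elements, and suppose that $\mathbb{F}_p G = B\otimes_{\mathbb{F}_p} C$ for some subalgebras $B$ and $C$ of $\mathbb{F}_p G$ such that $B$ is commutative. Then $G=\mathcal{B}\times \mathcal{C}$ for some subgroups $\mathcal{B}$ and $\mathcal{C}$ of $G$ such that $\mathbb{F}_p\mathcal{B}\cong B$ and $\mathbb{F}_p\mathcal{C}\cong C$ (isomorphisms of $\mathbb{F}_p$-algebras).
   Context: For subalgebras $B$ and $C$ of a $k$-algebra $A$ (subalgebras are unital, i.e. contain $1_A$), $A=B\otimes_k C$ means that the elements of $B$ commute with the elements of $C$ and the multiplication map $B\otimes_k C\to A$, $b\otimes c\mapsto bc$, is an isomorphism of $k$-algebras. $G=\mathcal{B}\times\mathcal{C}$ means that $G$ is the internal direct product of its subgroups $\mathcal{B}$ and $\mathcal{C}$. *)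

(* Defs.v *)
From HB Require Import structures.
From mathcomp Require Import all_boot all_order all_algebra all_fingroup.
From mathcomp Require Import all_solvable all_field.

Set Implicit Arguments.
Unset Strict Implicit.
Unset Printing Implicit Defensive.

Import GRing.Theory VectorInternalTheory.
Local Open Scope ring_scope.

(* Multinomials' {malg R[K]} requires the monoid K to have no non-trivial     *)
(* units, and mxrepresentation's group_ring is a space of matrices rather     *)
(* than a type, hence this construction of the group algebra as a falgType.   *)
Definition galg (F : fieldType) (gT : finGroupType) := {ffun gT -> F^o}.

Section GroupAlgebra.
Variables (F : fieldType) (gT : finGroupType).
Local Notation A := (galg F gT).
Implicit Types (u v w : A) (x y : gT).

HB.instance Definition _ := Vector.on A.

Definition galg_elt x : A := [ffun y => (x == y)%:R].

(* Convolution: the coefficient of u v at x is the sum of u(y) v(z), yz = x.  *)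
Definition galg_one : A := galg_elt 1%g.
Definition galg_mul u v : A := [ffun x => \sum_y u y * v (y^-1 * x)%g].

Fact galg_mulA : associative galg_mul.
Proof.
move=> u v w; apply/ffunP=> x; rewrite !ffunE.
under eq_bigr => y _ do rewrite ffunE mulr_sumr.
rewrite [RHS](eq_bigr (fun z => \sum_y (u y * v (y^-1 * z)%g) * w (z^-1 * x)%g)).
  rewrite [RHS]exchange_big /=; apply: eq_bigr => y _.
  rewrite [RHS](reindex_inj (mulgI y)) /=; apply: eq_bigr => z _.
  by rewrite mulKg invMg !mulgA mulrA.
by move=> z _; rewrite ffunE mulr_suml.
Qed.

Fact galg_mul1l : left_id galg_one galg_mul.
Proof.
move=> u; apply/ffunP=> x; rewrite ffunE (bigD1 1%g) //= big1 => [|y ny1].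
  by rewrite addr0 ffunE eqxx mul1r invg1 mul1g.
by rewrite ffunE eq_sym (negPf ny1) mul0r.
Qed.

Fact galg_mul1r : right_id galg_one galg_mul.
Proof.
move=> u; apply/ffunP=> x; rewrite ffunE (bigD1 x) //= big1 => [|y nyx].
  by rewrite addr0 ffunE mulVg eqxx mulr1.
by rewrite ffunE eq_mulVg1 invg1 mul1g -eq_mulVg1 (negPf nyx) mulr0.
Qed.

Fact galg_mulDl : left_distributive galg_mul +%R.
Proof.
move=> u v w; apply/ffunP=> x; rewrite !ffunE -big_split /=.
by apply: eq_bigr => y _; rewrite ffunE mulrDl.
Qed.

Fact galg_mulDr : right_distributive galg_mul +%R.
Proof.
move=> u v w; apply/ffunP=> x; rewrite !ffunE -big_split /=.
by apply: eq_bigr => y _; rewrite ffunE mulrDr.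
Qed.

Fact galg_oner_neq0 : galg_one != 0.
Proof.
apply/eqP=> /ffunP/(_ 1%g); rewrite !ffunE eqxx => /eqP.
by rewrite oner_eq0.
Qed.

HB.instance Definition _ := GRing.Zmodule_isNzRing.Build A
  galg_mulA galg_mul1l galg_mul1r galg_mulDl galg_mulDr galg_oner_neq0.

Fact galg_scaleAl (a : F) u v : a *: (u * v) = (a *: u) * v.
Proof.
apply/ffunP=> x; rewrite !ffunE scaler_sumr; apply: eq_bigr => y _.
by rewrite ffunE scalerAl.
Qed.
HB.instance Definition _ := GRing.Lmodule_isLalgebra.Build F A galg_scaleAl.

Fact galg_scaleAr (a : F) u v : a *: (u * v) = u * (a *: v).
Proof.
apply/ffunP=> x; rewrite !ffunE scaler_sumr; apply: eq_bigr => y _.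
by rewrite ffunE [in RHS]/GRing.scale /= /GRing.scale /= mulrCA.
Qed.
HB.instance Definition _ := GRing.Lalgebra_isAlgebra.Build F A galg_scaleAr.
HB.instance Definition _ := Algebra_isFalgebra.Build F A.

Lemma galg_eltM x y : galg_elt (x * y)%g = galg_elt x * galg_elt y.
Proof.
apply/ffunP=> z; rewrite !ffunE (bigD1 x) //= big1 => [|t ntx].
  by rewrite !ffunE eqxx mul1r addr0 -(inj_eq (mulgI x) y) mulKVg.
by rewrite ffunE eq_sym (negPf ntx) mul0r.
Qed.

Lemma galg_elt1 : galg_elt 1 = 1. Proof. by []. Qed.

Lemma galg_decomp u : u = \sum_x (u x : F) *: galg_elt x.
Proof.
apply/ffunP=> z; rewrite sum_ffunE (bigD1 z) //= big1 => [|t ntz].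
  by rewrite !ffunE eqxx addr0 /GRing.scale /= mulr1.
by rewrite !ffunE (negPf ntz) scaler0.
Qed.

End GroupAlgebra.

Notation group_algebra F G := (galg F (subg_of G)).

(* The tensor product of finite-dimensional spaces, in coordinates: the       *)
(* (i, j) entry is the coefficient on the tensor product of the i-th and j-th *)
(* standard basis vectors. The universal property is tlift_tens/tlift_unique. *)
Definition tensor (K : fieldType) (U V : vectType K) := 'M[K]_(dim U, dim V).

Section TensorSpace.
Variables (K : fieldType) (U V : vectType K).
Local Notation T := (tensor U V).

HB.instance Definition _ := Vector.on T.

Definition tens (u : U) (v : V) : T := (v2r u)^T *m v2r v.

Definition stdvec (W : vectType K) (i : 'I_(dim W)) : W := r2v (delta_mx 0 i).

Definition tlift (W : lmodType K) (f : U -> V -> W) (t : T) : W :=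
  \sum_i \sum_j t i j *: f (stdvec i) (stdvec j).

Lemma stdvec_decomp (W : vectType K) (w : W) :
  w = \sum_i v2r w 0 i *: stdvec i.
Proof.
apply: (can_inj v2rK); rewrite linear_sum /= [LHS]row_sum_delta.
by apply: eq_bigr => i _; rewrite linearZ /= r2vK.
Qed.

Lemma tens_linear_l v : linear (tens^~ v).
Proof. by move=> a u u'; rewrite /tens !linearP /= mulmxDl -scalemxAl. Qed.

Lemma tens_linear_r u : linear (tens u).
Proof. by move=> a v v'; rewrite /tens linearP /= mulmxDr -scalemxAr. Qed.

Lemma tens_stdvec i j : tens (stdvec i) (stdvec j) = delta_mx i j.
Proof. by rewrite /tens !r2vK trmx_delta mul_delta_mx. Qed.

Lemma tensor_decomp (t : T) :
  t = \sum_i \sum_j t i j *: tens (stdvec i) (stdvec j).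
Proof.
rewrite {1}[t]matrix_sum_delta; apply: eq_bigr => i _; apply: eq_bigr => j _.
by rewrite tens_stdvec.
Qed.

Lemma tlift_is_linear (W : lmodType K) (f : U -> V -> W) : linear (tlift f).
Proof.
move=> a s t; rewrite /tlift scaler_sumr -big_split; apply: eq_bigr => i _.
rewrite scaler_sumr -big_split; apply: eq_bigr => j _ /=.
by rewrite !mxE scalerDl scalerA.
Qed.

HB.instance Definition _ (W : lmodType K) (f : U -> V -> W) :=
  GRing.isLinear.Build K T W _ (tlift f) (tlift_is_linear f).

Lemma tlift_tens (W : lmodType K) (f : U -> V -> W) :
  (forall v, linear (f^~ v)) -> (forall u, linear (f u)) ->
  forall u v, tlift f (tens u v) = f u v.
Proof.
move=> fl fr u v.
pose Hl := fun v => GRing.isLinear.Build K U W _ (f^~ v) (fl v).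
pose gl v : {linear U -> W} := HB.pack (f^~ v) (Hl v).
pose Hr := fun u => GRing.isLinear.Build K V W _ (f u) (fr u).
pose gr u : {linear V -> W} := HB.pack (f u) (Hr u).
have -> : f u v = gl v u by [].
rewrite [in RHS](stdvec_decomp u) linear_sum; apply: eq_bigr => i _.
rewrite linearZ /=; have -> : f (stdvec i) v = gr (stdvec i) v by [].
rewrite [in RHS](stdvec_decomp v) linear_sum scaler_sumr.
apply: eq_bigr => j _; rewrite linearZ /= scalerA; congr (_ *: _).
by rewrite !mxE big_ord1 !mxE.
Qed.

Lemma tlift_unique (W : lmodType K) (f : U -> V -> W) (g : {linear T -> W}) :
  (forall u v, g (tens u v) = f u v) -> g =1 tlift f.
Proof.
move=> gE t; rewrite {1}[t]tensor_decomp linear_sum; apply: eq_bigr => i _.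
by rewrite linear_sum; apply: eq_bigr => j _; rewrite linearZ /= gE.
Qed.

Lemma tensor_ind (P : T -> Prop) :
  P 0 -> (forall s t, P s -> P t -> P (s + t)) ->
  (forall u v, P (tens u v)) -> forall t, P t.
Proof.
move=> P0 PD Pt t; rewrite [t]tensor_decomp.
apply: big_ind => // i _; apply: big_ind => // j _.
rewrite /tens scalemxAl -linearZ -linearZ /=; exact: Pt.
Qed.

End TensorSpace.

Section TensorAlgebra.
Variables (K : fieldType) (B C : falgType K).
Local Notation T := (tensor B C).
Implicit Types (s t : T).

(* The algebra structure with (b (x) c) (b' (x) c') = bb' (x) cc'.            *)
Definition tensor_mul s t : T :=
  tlift (fun b c => tlift (fun b' c' => tens (b * b') (c * c')) t) s.
Definition tensor_one : T := tens 1 1.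

Lemma tensor_mul_tensl b c t :
  tensor_mul (tens b c) t = tlift (fun b' c' => tens (b * b') (c * c')) t.
Proof.
rewrite /tensor_mul tlift_tens // => [c0|b0] a x y;
  rewrite /tlift scaler_sumr -big_split; apply: eq_bigr => i _;
  rewrite scaler_sumr -big_split; apply: eq_bigr => j _ /=;
  rewrite scalerA mulrC -scalerA -scalerDr; congr (_ *: _);
  by rewrite mulrDl -scalerAl (tens_linear_l, tens_linear_r).
Qed.

Lemma tensor_mul_tens b c b' c' :
  tensor_mul (tens b c) (tens b' c') = tens (b * b') (c * c').
Proof.
rewrite tensor_mul_tensl tlift_tens // => [c0|b0] a x y;
  by rewrite mulrDr -scalerAr (tens_linear_l, tens_linear_r).
Qed.

Fact tensor_mulDl : left_distributive tensor_mul +%R.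
Proof. by move=> s s' t; rewrite /tensor_mul linearD. Qed.

Fact tensor_scaleAl (a : K) s t : a *: tensor_mul s t = tensor_mul (a *: s) t.
Proof. by rewrite /tensor_mul linearZ. Qed.

Lemma tensor_mul_linear_r s : linear (tensor_mul s).
Proof.
move=> a t t'; rewrite /tensor_mul {1 3 4}/tlift.
rewrite scaler_sumr -big_split; apply: eq_bigr => i _.
rewrite scaler_sumr -big_split; apply: eq_bigr => j _ /=.
by rewrite linearP /= scalerDr !scalerA mulrC.
Qed.

Fact tensor_mulDr : right_distributive tensor_mul +%R.
Proof. by move=> s t t'; rewrite -{1}[t]scale1r tensor_mul_linear_r scale1r. Qed.

Lemma tensor_mul0 s : tensor_mul s 0 = 0.
Proof. by apply: (addrI (tensor_mul s 0)); rewrite -tensor_mulDr !addr0. Qed.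

Lemma tensor_0mul t : tensor_mul 0 t = 0.
Proof. by rewrite /tensor_mul linear0. Qed.

Fact tensor_scaleAr (a : K) s t : a *: tensor_mul s t = tensor_mul s (a *: t).
Proof.
by rewrite -[in RHS](addr0 (a *: t)) tensor_mul_linear_r tensor_mul0 addr0.
Qed.

Fact tensor_mulA : associative tensor_mul.
Proof.
move=> r s t; elim/tensor_ind: r => [|r r' IH IH'|b c].
- by rewrite !tensor_0mul.
- by rewrite !tensor_mulDl IH IH'.
elim/tensor_ind: s => [|s s' IH IH'|b' c'].
- by rewrite tensor_mul0 !tensor_0mul tensor_mul0.
- by rewrite tensor_mulDr !tensor_mulDl tensor_mulDr IH IH'.
elim/tensor_ind: t => [|t t' IH IH'|b'' c''].
- by rewrite !tensor_mul0.
- by rewrite !tensor_mulDr IH IH'.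
by rewrite !tensor_mul_tens !mulrA.
Qed.

Fact tensor_mul1l : left_id tensor_one tensor_mul.
Proof.
move=> t; elim/tensor_ind: t => [|s t IHs IHt|b c]; first exact: tensor_mul0.
  by rewrite tensor_mulDr IHs IHt.
by rewrite tensor_mul_tens !mul1r.
Qed.

Fact tensor_mul1r : right_id tensor_one tensor_mul.
Proof.
move=> t; elim/tensor_ind: t => [|s t IHs IHt|b c]; first exact: tensor_0mul.
  by rewrite tensor_mulDl IHs IHt.
by rewrite tensor_mul_tens !mulr1.
Qed.

Fact tensor_oner_neq0 : tensor_one != 0.
Proof.
have nz (A : falgType K) : exists i, v2r (1 : A) 0 i != 0.
  apply/existsP; apply: contraNT (oner_neq0 A) => /existsPn v0.
  rewrite -(inj_eq (can_inj v2rK)) linear0; apply/eqP/rowP=> i.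
  by rewrite mxE; apply/eqP; have:= v0 i; rewrite negbK.
have [[i nzi] [j nzj]] := (nz B, nz C).
apply/eqP=> /matrixP/(_ i j)/eqP; rewrite !mxE big_ord1 mxE.
by rewrite mulf_eq0 (negPf nzi) (negPf nzj).
Qed.

HB.instance Definition _ := GRing.Zmodule_isNzRing.Build T
  tensor_mulA tensor_mul1l tensor_mul1r tensor_mulDl tensor_mulDr
  tensor_oner_neq0.
HB.instance Definition _ := GRing.Lmodule_isLalgebra.Build K T tensor_scaleAl.
HB.instance Definition _ := GRing.Lalgebra_isAlgebra.Build K T tensor_scaleAr.

End TensorAlgebra.

Definition alg_iso (K : fieldType) (A A' : algType K) (f : A -> A') : Prop :=
  [/\ linear f, monoid_morphism f & bijective f].

Definition alg_isomorphic (K : fieldType) (A A' : algType K) : Prop :=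
  exists f : A -> A', alg_iso f.

Section InternalTensor.
Variables (K : fieldType) (A : falgType K).

(* An {aspace A} has an identity of its own; it is a unital subalgebra of A   *)
(* when that identity is 1.                                                   *)
Definition unital_subalg (B : {aspace A}) : Prop := 1 \in B.

Lemma unital_subalg_one (B : {aspace A}) :
  unital_subalg B -> vsval (1 : subvs_of B) = 1.
Proof. by move=> B1; rewrite -[LHS]mulr1 algidl. Qed.

Definition tensor_mulmap (B C : {aspace A}) :
    tensor (subvs_of B) (subvs_of C) -> A :=
  tlift (fun b c => vsval b * vsval c).

Lemma tensor_mulmap_tens (B C : {aspace A}) b c :
  tensor_mulmap (tens b c : tensor (subvs_of B) (subvs_of C))
    = vsval b * vsval c.
Proof.
rewrite /tensor_mulmap tlift_tens // => v a x y.
  by rewrite linearP /= mulrDl scalerAl.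
by rewrite linearP /= mulrDr scalerAr.
Qed.

Definition internal_tensor (B C : {aspace A}) : Prop :=
  {in B & C, forall b c, b * c = c * b} /\ alg_iso (@tensor_mulmap B C).

End InternalTensor.

(* Main.v *)
From HB Require Import structures.
Require Import Defs.
From mathcomp Require Import all_boot all_order all_algebra all_fingroup.
From mathcomp Require Import all_solvable all_field.

(* The factorization yields retractions e and c of A = F_p G onto B and C,    *)
(* the image of e being central and c \o e the augmentation. One cyclic       *)
(* direct factor <[h]> of G is split off at a time. If B is not trivial, a    *)
(* fixed point argument gives a nonzero functional D, additive on G, with D   *)
(* \o e = D; and D is nonzero on 'Z(G) because the noncentral classes of G    *)
(* have sizes divisible by p. For h in 'Z(G) of minimal order with D h != 0,  *)
(* <[h]> has a complement H on which D vanishes. As D (e h) = D h, the        *)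
(* endomorphism of A that maps h to e h and fixes H is bijective; after       *)
(* conjugation by it, e h = h and c h = 1, so that e and c descend to F_p H = *)
(* A / (h - 1)A.                                                              *)

Set Implicit Arguments.
Unset Strict Implicit.
Unset Printing Implicit Defensive.

Import GRing.Theory.
Local Open Scope ring_scope.

(** Let e and c be the maps b c |-> aug(c) b and b c |-> aug(b) c from A = F_p G onto B and C; B is
    central in A because it is commutative and commutes with C. It suffices to find G = Q x R such
    that e maps F_p Q bijectively onto B and c maps F_p R bijectively onto C
    ([tensor_pair_realizable], [realizes_isomorphic]). Injectivity is a single check: for a p-group,
    a nonzero kernel of an algebra map contains the sum of all group elements ([galg_hom_inj]).

    The proof is by induction on the order of G. If e is trivial on G, then c is the identity and Q
    = 1. Otherwise there is a nontrivial homomorphism D from G to F_p whose linear extension is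
    invariant under e ([idempotent_additive]). A central h of least order outside its kernel has
    maximal order in a suitable abelian quotient of G, hence a complement H ([split_cyclic]).

    The element e h need not lie in G, but replacing h by e h is an automorphism alpha of A
    ([shift_automorphism]): D (e h) = D h makes rho (e h) - 1 a unit multiple of h - 1, where rho
    projects onto F_p <[h]>. After conjugation by alpha, e fixes h and c sends it to 1, so both maps
    descend to A / (h - 1) A = F_p H; the factorization of H lifts back because h - 1 is nilpotent
    ([cycle_step]). *)

Definition lrmorphism_of (K : fieldType) (A A' : algType K) (f : A -> A')
    (lf : linear f) (mf : monoid_morphism f) : {lrmorphism A -> A'} :=
  HB.pack f (GRing.isLinear.Build K A A' _ f lf)
            (GRing.isMonoidMorphism.Build A A' f mf).

(** * Group algebras: universal property, augmentation, supports, subgroup sums *)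

Section GroupAlgebraLift.
Variables (F : fieldType) (gT : finGroupType).
Local Notation A := (galg F gT).
Local Notation elt := (galg_elt F).
Implicit Types (u v : A) (x y : gT).

Definition galg_lift (V : lmodType F) (f : gT -> V) u : V :=
  \sum_x (u x : F) *: f x.

Fact galg_lift_is_linear (V : lmodType F) (f : gT -> V) : linear (galg_lift f).
Proof.
move=> a u v; rewrite /galg_lift scaler_sumr -big_split.
by apply: eq_bigr => x _; rewrite !ffunE /= scalerDl scalerA.
Qed.

HB.instance Definition _ (V : lmodType F) (f : gT -> V) :=
  GRing.isLinear.Build F A V _ (galg_lift f) (galg_lift_is_linear f).

Lemma galg_lift_elt (V : lmodType F) (f : gT -> V) x :
  galg_lift f (elt x) = f x.
Proof.
rewrite /galg_lift (bigD1 x) //= big1 => [|y nyx].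
  by rewrite addr0 ffunE eqxx scale1r.
by rewrite ffunE eq_sym (negPf nyx) scale0r.
Qed.

Lemma galg_linearE (V : lmodType F) (f : {linear A -> V}) u :
  f u = \sum_x (u x : F) *: f (elt x).
Proof.
rewrite {1}[u]galg_decomp linear_sum; apply: eq_bigr => x _.
by rewrite linearZ.
Qed.

Lemma galg_linear_ext (V : lmodType F) (f g : {linear A -> V}) :
  (forall x, f (elt x) = g (elt x)) -> f =1 g.
Proof.
by move=> fg u; rewrite !galg_linearE; apply: eq_bigr => x _; rewrite fg.
Qed.

Lemma galg_lift_monoid_morphism (A' : algType F) (f : gT -> A') :
  f 1%g = 1 -> {morph f : x y / (x * y)%g >-> x * y} ->
  monoid_morphism (galg_lift f).
Proof.
move=> f1 fM; split=> [|u v]; first by rewrite -galg_elt1 galg_lift_elt.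
rewrite {1}[u]galg_decomp mulr_suml linear_sum.
rewrite [galg_lift f u]/galg_lift mulr_suml.
apply: eq_bigr => x _; rewrite {1}[v]galg_decomp mulr_sumr linear_sum.
rewrite [galg_lift f v]/galg_lift mulr_sumr; apply: eq_bigr => y _ /=.
rewrite -scalerAl -scalerAr -galg_eltM !linearZ /= galg_lift_elt fM.
by rewrite -scalerAl -scalerAr.
Qed.

Fact galg_hom_exists (A' : algType F) (f : gT -> A') :
  f 1%g = 1 -> {morph f : x y / (x * y)%g >-> x * y} ->
  {g : {lrmorphism A -> A'} | forall x, g (elt x) = f x}.
Proof.
move=> f1 fM; exists (lrmorphism_of (galg_lift_is_linear f)
                                    (galg_lift_monoid_morphism f1 fM)).
exact: galg_lift_elt.
Qed.

(** The existence proof is opaque, so that this morphism is known only through its values on the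
    group, [galg_homE]. *)
Definition galg_hom (A' : algType F) (f : gT -> A') (f1 : f 1%g = 1)
    (fM : {morph f : x y / (x * y)%g >-> x * y}) : {lrmorphism A -> A'} :=
  sval (galg_hom_exists f1 fM).

Lemma galg_homE (A' : algType F) (f : gT -> A') f1 fM x :
  @galg_hom A' f f1 fM (elt x) = f x.
Proof. exact: (svalP (galg_hom_exists f1 fM)). Qed.

Lemma galg_eltX x n : elt (x ^+ n)%g = elt x ^+ n.
Proof. by elim: n => [|n IHn] //; rewrite expgS exprS galg_eltM IHn. Qed.

Lemma galg_commZ (a b : F) x y :
  (x * y = y * x)%g -> GRing.comm (a *: elt x) (b *: elt y).
Proof.
move=> cxy; rewrite /GRing.comm -!scalerAl -!scalerAr -!galg_eltM cxy.
by rewrite !scalerA mulrC.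
Qed.

Definition aug : {lrmorphism A -> F^o} :=
  @galg_hom F^o (fun=> 1) erefl (fun _ _ => esym (mulr1 1)).

Lemma aug_elt x : aug (elt x) = 1. Proof. exact: galg_homE. Qed.

Lemma augE u : aug u = \sum_x u x.
Proof.
rewrite (galg_linearE aug); apply: eq_bigr => x _.
by rewrite /= aug_elt [LHS]mulr1.
Qed.

Lemma galg_mul_eltl x u y : (elt x * u) y = u (x^-1 * y)%g.
Proof.
rewrite ffunE (bigD1 x) //= big1 => [|z nzx].
  by rewrite ffunE eqxx mul1r addr0.
by rewrite ffunE eq_sym (negPf nzx) mul0r.
Qed.

Lemma galg_mul_eltr x u y : (u * elt x) y = u (y * x^-1)%g.
Proof.
rewrite ffunE (bigD1 (y * x^-1)%g) //= big1 => [|z nz].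
  by rewrite ffunE invMg invgK mulgKV eqxx mulr1 addr0.
rewrite ffunE; case: eqP => [xE|]; last by rewrite mulr0.
by case/eqP: nz; rewrite xE invMg invgK mulKVg.
Qed.

Lemma galg_centralP u :
  (forall x, elt x * u = u * elt x) -> forall v, u * v = v * u.
Proof.
move=> cu v; rewrite [v]galg_decomp mulr_sumr mulr_suml.
by apply: eq_bigr => x _; rewrite -scalerAr -scalerAl cu.
Qed.

Lemma galg_central_class u :
  (forall v, u * v = v * u) <-> forall x y, u (x ^ y)%g = u x.
Proof.
split=> [cu x y|cu].
  by rewrite conjgE -galg_mul_eltl -cu galg_mul_eltr mulgK.
apply: galg_centralP => x; apply/ffunP=> y.
by rewrite galg_mul_eltl galg_mul_eltr -(cu _ x^-1%g) conjgE invgK -mulgA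
  mulKVg.
Qed.

(** The span of Q inside A, kept as a predicate so that several subgroups can be handled within one
    algebra. *)
Definition supported (Q : {set gT}) u := forall x, x \notin Q -> u x = 0.

Lemma supported0 Q : supported Q 0.
Proof. by move=> x _; rewrite ffunE. Qed.

Lemma supportedD Q u v : supported Q u -> supported Q v -> supported Q (u + v).
Proof. by move=> Qu Qv x Qx; rewrite ffunE Qu ?Qv ?addr0. Qed.

Lemma supportedN Q u : supported Q u -> supported Q (- u).
Proof. by move=> Qu x Qx; rewrite ffunE Qu ?oppr0. Qed.

Lemma supported_elt (Q : {set gT}) x : x \in Q -> supported Q (elt x).
Proof. by move=> Qx y; rewrite ffunE; case: eqP => // <-; rewrite Qx. Qed.

Lemma supported_sum (Q : {set gT}) (I : Type) (r : seq I) (P : pred I) (f : I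
  -> A) :
  (forall i, P i -> supported Q (f i)) -> supported Q (\sum_(i <- r | P i) f i).
Proof.
move=> Qf; apply: big_ind => //; [exact: supported0|exact: supportedD].
Qed.

Lemma supportedZ Q a u : supported Q u -> supported Q (a *: u).
Proof. by move=> Qu x Qx; rewrite ffunE Qu ?scaler0. Qed.

Lemma supportedM (Q : {group gT}) u v :
  supported Q u -> supported Q v -> supported Q (u * v).
Proof.
move=> Qu Qv x Qx; rewrite ffunE big1 // => y _.
have [Qy|Qy] := boolP (y \in Q); last by rewrite Qu ?mul0r.
by rewrite Qv ?mulr0 // groupMl ?groupV.
Qed.

Lemma supported1 (Q : {group gT}) : supported Q 1.
Proof. by rewrite -galg_elt1; apply: supported_elt. Qed.

Lemma supportedX (Q : {group gT}) u n : supported Q u -> supported Q (u ^+ n).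
Proof.
move=> Qu; elim: n => [|n IHn]; first exact: supported1.
by rewrite exprS; apply: supportedM.
Qed.

Lemma supportedS (Q R : {set gT}) u :
  Q \subset R -> supported Q u -> supported R u.
Proof. by move=> sQR Qu x Rx; apply: Qu; apply: contra Rx; apply: subsetP. Qed.

Lemma supportedE (Q : {set gT}) u :
  supported Q u -> u = \sum_(x in Q) (u x : F) *: elt x.
Proof.
move=> Qu; rewrite {1}[u]galg_decomp [RHS]big_mkcond; apply: eq_bigr => x _.
by case: ifPn => // /Qu->; rewrite scale0r.
Qed.

Definition gsum (Q : {set gT}) : A := \sum_(x in Q) elt x.

Lemma gsumE Q x : gsum Q x = (x \in Q)%:R.
Proof.
rewrite sum_ffunE; have [Qx|Qx] := boolP (x \in Q).
  rewrite (bigD1 x) //= big1 => [|y /andP[_ nyx]].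
    by rewrite ffunE eqxx addr0.
  by rewrite ffunE (negPf nyx).
by rewrite big1 // => y Qy; rewrite ffunE; case: eqP Qx => // <-; rewrite Qy.
Qed.

Lemma supported_gsum Q : supported Q (gsum Q).
Proof. by move=> x Qx; rewrite gsumE (negPf Qx). Qed.

(** Factorization in K H is unique, so a single term of the convolution survives. *)
Lemma galg_mul_dprod (K H : {group gT}) u v x y :
  (K :&: H = 1)%g -> supported K u -> supported H v -> x \in K -> y \in H ->
  (u * v) (x * y)%g = u x * v y.
Proof.
move=> tiKH Ku Hv Kx Hy; rewrite ffunE (bigD1 x) //= big1 => [|z nzx].
  by rewrite mulKg addr0.
have [Kz|Kz] := boolP (z \in K); last by rewrite Ku ?mul0r.
rewrite Hv ?mulr0 // mulgA groupMr //; apply: contra nzx => Hzx.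
have: (z^-1 * x \in K :&: H)%g by rewrite inE Hzx groupM ?groupV.
by rewrite tiKH => /set1gP/(canRL (mulKVg _)); rewrite mulg1 => ->.
Qed.

Lemma gsum_dprod (K H G : {group gT}) :
  (K \x H = G)%g -> gsum K * gsum H = gsum G.
Proof.
case/dprodP=> _ defG cKH tiKH; apply/ffunP=> x; rewrite gsumE -defG.
have [/mulsgP[k h Kk Hh ->]|KHx] := boolP (x \in _).
  rewrite (galg_mul_dprod tiKH) ?gsumE ?Kk ?Hh ?mulr1 //; exact: supported_gsum.
have sub1 : K \subset (K <*> H)%G by apply: joing_subl.
have sub2 : H \subset (K <*> H)%G by apply: joing_subr.
apply: (@supportedM (K <*> H)%G); last by rewrite /= cent_joinEr.
  exact: supportedS (supported_gsum (Q := K)).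
exact: supportedS (supported_gsum (Q := H)).
Qed.

Lemma gsum_fixed u : (forall x, u * elt x = u) -> u = (u 1%g : F) *: gsum setT.
Proof.
move=> fu; apply/ffunP=> x; rewrite !ffunE gsumE inE.
by rewrite -{1}(fu x) galg_mul_eltr mulgV [RHS]mulr1.
Qed.

End GroupAlgebraLift.

(** * Frobenius powers of commuting elements *)

Section PowersInCharP.
Variables (R : nzRingType) (p : nat).
Hypothesis pcharR : p \in [pchar R].

Lemma exprD_comm_pchar (x y : R) k :
  GRing.comm x y -> (x + y) ^+ (p ^ k) = x ^+ (p ^ k) + y ^+ (p ^ k).
Proof.
move=> cxy; elim: k => [|k IHk]; first by rewrite !expr1.
rewrite expnSr !exprM IHk -!(pFrobenius_autE pcharR) pFrobenius_autD_comm //.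
exact/commrX/commr_sym/commrX/commr_sym.
Qed.

Lemma exprB1_pchar (x : R) k : (x - 1) ^+ (p ^ k) = x ^+ (p ^ k) - 1.
Proof.
elim: k => [|k IHk]; first by rewrite !expr1.
rewrite expnSr !exprM IHk -!(pFrobenius_autE pcharR) pFrobenius_autB_comm.
  by rewrite pFrobenius_aut1.
exact: commr1.
Qed.

Lemma expr_sum_comm_pchar (I : Type) (r : seq I) (P : pred I) (f : I -> R) k :
  (forall i j, P i -> P j -> GRing.comm (f i) (f j)) ->
  (\sum_(i <- r | P i) f i) ^+ (p ^ k) = \sum_(i <- r | P i) f i ^+ (p ^ k).
Proof.
have p_gt0 : (0 < p ^ k)%N.
  by rewrite expn_gt0 prime_gt0 // (pcharf_prime pcharR).
move=> cf; elim: r => [|i r IHr]; first by rewrite !big_nil expr0n gtn_eqF.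
rewrite !big_cons; case: ifP => // Pi; rewrite exprD_comm_pchar ?IHr //.
by apply: commr_sum => j Pj; apply: cf.
Qed.

End PowersInCharP.

(** * p-groups acting on spaces over F_p *)

Lemma Fp_expX p (a : 'F_p) k : prime p -> a ^+ (p ^ k) = a.
Proof.
move=> p_pr; elim: k => [|k IHk]; first exact: expr1.
by rewrite expnSr exprM IHk -[in X in _ ^+ X](card_Fp p_pr) expf_card.
Qed.

Lemma pchar_galg p (gT : finGroupType) : prime p -> p \in [pchar galg 'F_p gT].
Proof. by move=> p_pr; rewrite pchar_lalg pchar_Fp. Qed.

Lemma card_vspace_Fp p (V : vectType 'F_p) (U : {vspace V}) :
  prime p -> #|[set u : finvect_type V | (u : V) \in U]| = (p ^ \dim U)%N.
Proof.
case: V U => T cT U p_pr; rewrite cardsE.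
by have := @card_vspace 'F_p (finvect_type (Vector.Pack cT)) cT U;
  rewrite card_Fp.
Qed.

(** The number of fixed points is congruent to the cardinal of U, a positive power of p, hence to 0
    modulo p; since 0 is fixed, there is another one. *)
Lemma pgroup_fixed_vector p (V : vectType 'F_p) (U : {vspace V})
    (gT : finGroupType) (to : V -> gT -> V) :
  prime p -> (p.-group [set: gT])%g ->
  (forall x, linear (to^~ x)) -> (forall u, to u 1%g = u) ->
  (forall u x y, to u (x * y)%g = to (to u x) y) ->
  (forall u x, u \in U -> to u x \in U) ->
  U != 0%VS -> exists u, [/\ u \in U, u != 0 & forall x, to u x = u].
Proof.
move=> p_pr pG tolin to1 toM toU nzU.
pose T : finType := finvect_type V.
have toA : is_action [set: gT] (to : T -> gT -> T).
  by split=> [x u v /(congr1 (to^~ x^-1)%g)|u x y _ _];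
    rewrite -?toM ?mulgV ?to1.
pose act := Action toA.
pose S : {set T} := [set u : T | (u : V) \in U].
have cardS : #|S| = (p ^ \dim U)%N.
  exact: card_vspace_Fp.
have acts : [acts [set: gT], on S | act].
  apply/actsP=> x _ u; rewrite !inE /=;
    apply/idP/idP=> [/(toU _ x^-1%g)|/toU //].
  by rewrite -toM mulgV to1.
have := pgroup_fix_mod pG acts; rewrite cardS.
have [d ->] : exists d, \dim U = d.+1.
  by exists (\dim U).-1; rewrite prednK // lt0n dimv_eq0.
rewrite expnS modnMr => /esym/eqP dvdp.
have S0 : (0 : V) \in ('Fix_(S | act)([set: gT]))%g.
  apply/setIP; rewrite inE mem0v; split=> //; apply/afixP=> x _.
  have L := tolin x; pose f : {linear V -> V} := HB.pack (to^~ x)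
     (GRing.isLinear.Build _ _ _ _ (to^~ x) L).
  exact: (linear0 f).
have: (1 < #|('Fix_(S | act)([set: gT]))%g|)%N.
  by apply: leq_trans (prime_gt1 p_pr) (dvdn_leq _ dvdp); apply/card_gt0P;
    exists 0.
case/card_gt1P=> u [v [/setIP[Su fu] /setIP[Sv fv] nuv]].
wlog nzu: u v Su fu Sv fv nuv / u != 0.
  move=> W; have [u0|] := eqVneq u 0; last exact: (W u v).
  by apply: (W v u) => //; rewrite eq_sym // -u0.
exists u; split=> //; first by rewrite inE in Su.
by move=> x; apply: (afixP fu); rewrite inE.
Qed.

(** The fibre of f over a nonzero value is stable under conjugation and has no fixed point, as these
    would be central. Its size is thus divisible by p. *)
Lemma sum_class_function p (gT : finGroupType) (f : gT -> 'F_p) :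
  prime p -> (p.-group [set: gT])%g ->
  (forall x y, f (x ^ y)%g = f x) ->
  (forall x, x \in 'Z([set: gT])%g -> f x = 0) -> \sum_x f x = 0.
Proof.
move=> p_pr pG fJ fZ; rewrite (partition_big f predT) //= big1 // => a _.
rewrite (eq_bigr (fun=> a)) => [|x /eqP //]; rewrite sumr_const.
have [->|nza] := eqVneq a 0; first by rewrite mul0rn.
pose S := [set x | f x == a].
have nS : [acts [set: gT], on S | 'J].
  by apply/actsP=> y _ x; rewrite !inE /= fJ.
have -> : #|[pred x | f x == a]| = #|S| by rewrite cardsE.
have := pgroup_fix_mod pG nS; rewrite afixJ.
suff -> : S :&: 'C([set: gT])%g = set0.
  rewrite cards0 mod0n => /eqP /dvdnP[m ->].
  by rewrite mulrnA -mulr_natr (pcharf0 (pchar_Fp p_pr)) mulr0.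
apply/setP=> x; rewrite !inE; apply/negbTE/andP=> -[/eqP fxa Cx].
by case/eqP: nza; rewrite -fxa fZ // inE inE.
Qed.

(** The identity is proved in [{poly 'F_p}], where ['X - 1] may be cancelled, and then evaluated at
    x, for which [x - 1] may be a zero divisor. *)
Lemma sum_expr_pchar p (A : algType 'F_p) (x : A) k : prime p ->
  \sum_(i < p ^ k) x ^+ i = (x - 1) ^+ (p ^ k).-1.
Proof.
move=> p_pr; have q_gt0 : (0 < p ^ k)%N by rewrite expn_gt0 prime_gt0.
have pchP : p \in [pchar {poly 'F_p}] by rewrite pchar_poly pchar_Fp.
suff E : \sum_(i < p ^ k) 'X ^+ i = ('X - 1) ^+ (p ^ k).-1 :> {poly 'F_p}.
  have := congr1 (horner_alg x) E;
    rewrite rmorph_sum rmorphXn rmorphB rmorph1 /=.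
  rewrite horner_algX => <-; apply: eq_bigr => i _.
  by rewrite rmorphXn /= horner_algX.
apply: (mulfI (monic_neq0 (monicXsubC 1))).
by rewrite -subrX1 -exprS prednK // exprB1_pchar.
Qed.

(* A nonzero kernel would contain a nonzero vector fixed by G, that is, a     *)
(* multiple of gsum setT.                                                     *)
Lemma galg_hom_inj p (gT : finGroupType) (A' : falgType 'F_p)
    (f : {lrmorphism galg 'F_p gT -> A'}) :
  prime p -> (p.-group [set: gT])%g -> f (gsum _ setT) != 0 -> injective f.
Proof.
move=> p_pr pG nzf; apply: raddf_inj => u fu0; apply/eqP/negPn/negP=> nzu.
pose to (u : galg 'F_p gT) x := u * galg_elt _ x.
have nzK : lker (linfun f) != 0%VS.
  by apply: contra nzu => /eqP K0; rewrite -memv0 -K0 memv_ker lfunE /= fu0.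
have [||||v [Kv nzv fv]] := pgroup_fixed_vector (to := to) p_pr pG _ _ _ _ nzK.
- by move=> x a v w; rewrite /to mulrDl scalerAl.
- by move=> v; rewrite /to galg_elt1 mulr1.
- by move=> v x y; rewrite /to galg_eltM mulrA.
- move=> v x; rewrite !memv_ker !lfunE /= => /eqP fv; rewrite /to rmorphM /= fv.
  by rewrite mul0r.
move: Kv; rewrite memv_ker lfunE /= (gsum_fixed fv) linearZ /= scaler_eq0.
rewrite (negPf nzf) orbF => /eqP v1; case/negP: nzv.
by rewrite (gsum_fixed fv) v1 scale0r.
Qed.

(** Pointwise form of the linearity of [L] and [to] in [idempotent_additive]. *)
Lemma scale_sub_add (K : fieldType) (V : lmodType K) (a : K) (x x' y y' z z' :
  V) :
  (a *: x + x') - (a *: y + y') + (a *: z + z')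
    = a *: (x - y + z) + (x' - y' + z').
Proof.
rewrite scalerDr scalerBr opprD [RHS]addrACA; congr (_ + _).
exact: addrACA.
Qed.

(** * Additive functionals and the center of the group *)

Section Central.
Variables (p : nat) (gT : finGroupType).
Hypotheses (p_pr : prime p) (pG : (p.-group [set: gT])%g).
Local Notation A := (galg 'F_p gT).
Local Notation elt := (galg_elt 'F_p).
Local Notation Z := 'Z([set: gT])%g.

Let centerJ x y : ((x ^ y)%g \in Z) = (x \in Z).
Proof. by rewrite memJ_norm // (subsetP (gFnorm _ _)) // inE. Qed.

Let center_fix x y : x \in Z -> (x ^ y)%g = x.
Proof.
by case/centerP=> _ /(_ y (in_setT y)) c; rewrite conjgE c mulKg.
Qed.

(** As y is central, the terms of the convolution at y form a class function of the summation
    variable, and this function vanishes on the center. *)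
Lemma central_mul_off_center (s c : A) y :
  (forall w, s * w = w * s) -> (forall w, c * w = w * c) ->
  (forall x, x \in Z -> s x = 0) -> y \in Z -> (s * c) y = 0.
Proof.
move=> /galg_central_class sJ /galg_central_class cJ sZ Zy; rewrite ffunE.
apply: sum_class_function => // [x w|x Zx]; last by rewrite sZ ?mul0r.
by rewrite sJ -[in RHS](cJ _ w) conjMg conjVg (center_fix w Zy).
Qed.

Definition grp_additive (D : A -> ('F_p)^o) :=
  forall x y, D (elt (x * y)%g) = D (elt x) + D (elt y).

Section Additive.
Variable D : {linear A -> ('F_p)^o}.
Hypothesis addD : grp_additive D.

Lemma grp_additive1 : D (elt 1%g) = 0.
Proof.
by apply: (addrI (D (elt 1%g))); rewrite -addD mulg1 addr0.
Qed.

Lemma grp_additiveV x : D (elt x^-1%g) = - D (elt x).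
Proof. by apply/eqP; rewrite -addr_eq0 -addD mulVg grp_additive1. Qed.

Lemma grp_additiveX x n : D (elt (x ^+ n)%g) = D (elt x) *+ n.
Proof.
by elim: n => [|n IHn]; rewrite ?grp_additive1 // expgS addD IHn mulrS.
Qed.

Lemma grp_additiveJ x y : D (elt (x ^ y)%g) = D (elt x).
Proof. by rewrite conjgE !addD grp_additiveV addrC -addrA subrr addr0. Qed.

(* Truncating v to 'Z(G) changes neither D v nor v ^+ (p ^ k) = 1, because    *)
(* the central elements that vanish on 'Z(G) form an ideal of the center of   *)
(* A. As coefficients in F_p are fixed by Frobenius, the power p ^ k then     *)
(* only acts on the elements of 'Z(G).                                        *)
Lemma grp_additive_root (v : A) k :
  (forall w, v * w = w * v) -> v ^+ (p ^ k) = 1 ->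
  (forall x, x \in Z -> (x ^+ (p ^ k) = 1)%g -> D (elt x) = 0) -> D v = 0.
Proof.
move=> cv vq DZ.
have q_gt0 : (0 < p ^ k)%N by rewrite expn_gt0 prime_gt0.
pose z : A := \sum_(x in Z) (v x : 'F_p) *: elt x; pose s := v - z.
have zE x : z x = if x \in Z then v x else 0.
  have Zz : supported Z z.
    by apply: supported_sum => y Zy; apply/supportedZ/supported_elt.
  have [Zx|/Zz //] := ifPn; rewrite sum_ffunE (bigD1 x) //= big1 => [|y].
    by rewrite !ffunE eqxx [_ *: _]mulr1 addr0.
  by case/andP=> _ nyx; rewrite !ffunE (negPf nyx) scaler0.
have vJ := (galg_central_class v).1 cv.
have cz : forall w, z * w = w * z.
  by apply/galg_central_class => x y; rewrite !zE centerJ vJ.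
have cs : forall w, s * w = w * s.
  by move=> w; rewrite mulrBl mulrBr cv cz.
have sZ x : x \in Z -> s x = 0 by move=> Zx; rewrite !ffunE zE Zx subrr.
have zq : z ^+ (p ^ k) = \sum_(x in Z) (v x : 'F_p) *: elt (x ^+ (p ^ k))%g.
  rewrite /z (expr_sum_comm_pchar (pchar_galg gT p_pr)) => [|x y Zx Zy].
    by apply: eq_bigr => x _; rewrite exprZn Fp_expX // galg_eltX.
  have cxy : (x * y = y * x)%g by case/centerP: Zx => _; apply; rewrite inE.
  exact: galg_commZ.
have zq1 : z ^+ (p ^ k) = 1.
  have Zzq : supported Z (z ^+ (p ^ k)).
    by apply: supportedX => x; rewrite zE => /negPf->.
  apply/ffunP=> y; have [Zy|nZy] := boolP (y \in Z); last first.
    by rewrite Zzq // (@supported1 _ gT 'Z([set: gT])%G).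
  have -> : (1 : A) = z ^+ (p ^ k) + s ^+ (p ^ k).
    rewrite -(exprD_comm_pchar (pchar_galg gT p_pr)); last exact: cz.
    by rewrite [z + s]addrC subrK.
  rewrite ffunE -[in X in _ + X](prednK q_gt0) exprS central_mul_off_center
    ?addr0 //.
  by move=> w; apply/commr_sym/commrX; rewrite /GRing.comm cs.
(* A choice of [p ^ k]-th roots in [Z]. Two roots of one element differ by an element whose
   [p ^ k]-th power is 1, so [DZ] makes [D] independent of the choice; the default is harmless
   because [r] matters only on [p ^ k]-th powers. *)
pose r y := odflt 1%g [pick x in Z | (x ^+ (p ^ k) == y)%g].
have Dr x : x \in Z -> D (elt (r (x ^+ (p ^ k))%g)) = D (elt x).
  move=> Zx; rewrite /r; case: pickP => [y /andP[Zy /eqP yq]|/(_ x)];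
    last first.
    by rewrite Zx eqxx.
  have cxy : commute x y^-1%g by case/centerP: Zx => _; apply; rewrite inE.
  have D0 : D (elt (x * y^-1)%g) = 0.
    by apply: DZ; rewrite ?groupM ?groupV // expgMn // expgVn yq mulgV.
  by rewrite -[in RHS](mulgKV y x) [RHS]addD D0 add0r.
have Dz : D z = 0.
  rewrite -[RHS](_ : galg_lift (fun x => D (elt (r x))) (z ^+ (p ^ k)) = 0);
    last first.
    rewrite zq1 -galg_elt1 galg_lift_elt -[X in r X](expg1n _ (p ^ k)) Dr
      ?group1 //.
    exact: grp_additive1.
  rewrite zq !linear_sum; apply: eq_bigr => x Zx.
  by rewrite !linearZ /= galg_lift_elt Dr.
rewrite -[v](subrK z) linearD /= Dz addr0 (galg_linearE D).
apply: sum_class_function => // [x y|x Zx]; last by rewrite sZ // scale0r.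
by rewrite grp_additiveJ (galg_central_class s).1.
Qed.
End Additive.

Lemma pgroup_expX : exists k, forall x : gT, (x ^+ (p ^ k) = 1)%g.
Proof.
have [k oG] := p_natP pG; exists k => x.
by rewrite -oG; apply: expg_cardG; rewrite inE.
Qed.

(** A group element has p-power order, and raising to a power [p ^ k] is the identity on F_p, so f
    must send it to 1. *)
Lemma aug_unique (f : {lrmorphism A -> ('F_p)^o}) u : f u = aug _ _ u.
Proof.
apply: galg_linear_ext => x /=; rewrite aug_elt; have [k xk] := pgroup_expX.
rewrite -[LHS](Fp_expX _ k p_pr).
by transitivity (f (elt x) ^+ (p ^ k)) => //;
  rewrite -rmorphXn -galg_eltX xk rmorph1.
Qed.

(** * An invariant additive functional and the cyclic factor it yields *)

Section Idempotent.
Variable e : {lrmorphism A -> A}.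
Hypotheses (ee : forall u, e (e u) = e u) (ec : forall u v, e u * v = v * e u).

(** The e-invariant functionals that vanish at 1 form a nonzero space [U], stable under a twisted
    translation action of G. A nonzero fixed vector of this action is an additive functional. *)
Lemma idempotent_additive x0 : e (elt x0) != 1 ->
  exists D : {linear A -> ('F_p)^o},
    [/\ grp_additive D, forall u, D (e u) = D u & exists x, D (elt x) != 0].
Proof.
move=> ntx0; pose pair (phi : A) := galg_lift (phi : gT -> ('F_p)^o).
have pairE phi u : pair phi u = \sum_x (u x : 'F_p) * phi x by [].
have pair_elt phi x : pair phi (elt x) = phi x by exact: galg_lift_elt.
have pair_lin u : linear (pair^~ u).
  move=> a phi psi; rewrite /= !pairE scaler_sumr -big_split.
  by apply: eq_bigr => x _; rewrite !ffunE /= mulrDr mulrCA.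
(* One linear map encodes both conditions defining [U]: its value at 1 is [phi 1], and once this
   vanishes the other values compare [phi \o e] with [phi]. *)
pose L (phi : A) : A := [ffun x => pair phi (e (elt x)) - phi x + phi 1%g].
have Llin : linear L.
  move=> a phi psi; apply/ffunP=> x; rewrite !ffunE pair_lin.
  exact: scale_sub_add.
pose Lf : {linear A -> A} := HB.pack L (GRing.isLinear.Build _ _ _ _ L Llin).
pose U := lker (linfun Lf).
have UP (phi : A) : reflect (phi 1%g = 0 /\ forall u : A,
  pair phi (e u) = pair phi u)
                      (phi \in U).
  rewrite memv_ker lfunE /=; apply: (iffP eqP) => [L0|[phi1 phie]]; last first.
    by apply/ffunP=> x; rewrite !ffunE phie pair_elt subrr phi1 addr0.
  have Lx x : L phi x = 0 by rewrite [L phi]L0 ffunE.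
  have phi1 : phi 1%g = 0.
    by have := Lx 1%g; rewrite ffunE galg_elt1 rmorph1 -galg_elt1 pair_elt
      subrr add0r.
  pose f := galg_lift (phi : gT -> ('F_p)^o); split=> //.
  apply: (@galg_linear_ext _ _ _ (f \o e) f) => x; rewrite /= [RHS]pair_elt.
  by apply/eqP; rewrite -subr_eq0; have /eqP := Lx x; rewrite ffunE phi1 addr0.
(* G acts on U by phi |-> phi (g _) - phi g, and the vectors it fixes are the *)
(* additive ones; the last term makes this an action on all functionals.      *)
pose to (phi : A) g : A := [ffun x => phi (g * x)%g - phi g + phi 1%g].
have pair_to (phi : A) g (u : A) : phi 1%g = 0 ->
    pair (to phi g) u = pair phi (elt g * u) - phi g * aug _ _ u.
  move=> phi1; rewrite augE mulr_sumr pairE (pairE _ (elt g * u)).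
  rewrite [X in _ = X - _](reindex_inj (mulgI g)) -sumrB; apply: eq_bigr => x _.
  by rewrite galg_mul_eltl mulKg ffunE phi1 addr0 mulrBr (mulrC (phi g)).
have nzU : U != 0%VS.
  have /eqP/ffunP nt := ntx0.
  have [y nty] : exists y, e (elt x0) y != (1 : A) y.
    apply/existsP; apply: contraR ntx0 => /existsPn E; apply/eqP/ffunP=> y.
    by apply/eqP; rewrite -[_ == _]negbK E.
  (* The coefficient at y of e u - aug(u) 1, as a functional of u: it vanishes at 1, is e-invariant
     since e is idempotent and preserves the augmentation, and is nonzero at [x0] by the choice of
     y. *)
  pose phi : A := [ffun x => e (elt x) y - (1 : A) y].
  have pairphi u : pair phi u = e u y - aug _ _ u * (1 : A) y.
    rewrite pairE augE mulr_suml (galg_linearE e) sum_ffunE -sumrB.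
    by apply: eq_bigr => x _; rewrite !ffunE mulrBr.
  have Uphi : phi \in U.
    apply/UP; split=> [|u]; first by rewrite ffunE galg_elt1 rmorph1 subrr.
    rewrite !pairphi ee; congr (_ - _ * _).
    exact: (aug_unique (aug _ _ \o e)).
  apply: contraNneq nty => U0; move: Uphi;
    rewrite U0 memv0 => /eqP/ffunP/(_ x0).
  by rewrite !ffunE => /eqP; rewrite subr_eq0.
have [||||phi [Uphi nzphi fphi]] := pgroup_fixed_vector (to :=
  to) p_pr pG _ _ _ _ nzU.
- move=> x a phi psi; apply/ffunP=> y; rewrite !ffunE.
  exact: scale_sub_add.
- by move=> phi; apply/ffunP=> y; rewrite ffunE mul1g subrK.
- move=> phi x y; apply/ffunP=> w; rewrite !ffunE mulg1 subrr add0r.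
  rewrite mulgA; congr (_ + _).
  by rewrite opprD addrACA subrr addr0 opprB addrA subrK.
- move=> phi g /UP[phi1 phie]; apply/UP; split.
    by rewrite ffunE mulg1 subrr add0r.
  move=> u; rewrite !pair_to // -phie -[in RHS]phie !rmorphM /= ee;
    congr (_ - _ * _).
  exact: (aug_unique (aug _ _ \o e)).
have [phi1 phie] := UP _ Uphi; exists (galg_lift (phi : gT -> ('F_p)^o)); split.
- move=> x y; rewrite /= !galg_lift_elt; have /ffunP/(_ y) := fphi x.
  by rewrite ffunE phi1 addr0 => <-; rewrite addrC subrK.
- exact: phie.
have [x nzx] : exists x, phi x != 0.
  apply/existsP; apply: contraR nzphi => /existsPn E; apply/eqP/ffunP=> y.
  by rewrite ffunE; apply/eqP; rewrite -[_ == _]negbK E.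
by exists x; rewrite /= galg_lift_elt.
Qed.

Lemma split_cyclic (D : {linear A -> ('F_p)^o}) x0 :
  grp_additive D -> (forall u, D (e u) = D u) -> D (elt x0) != 0 ->
  exists h (H : {group gT}),
    [/\ (<[h]> \x H = [set: gT])%g, D (elt h) != 0
      & forall x, x \in H -> D (elt x) = 0].
Proof.
move=> addD De nzD.
have Droot g k : e (elt g) ^+ (p ^ k) = 1 ->
    (forall x, x \in Z -> (x ^+ (p ^ k) = 1)%g -> D (elt x) = 0) ->
    D (elt g) = 0.
  by move=> eg DZ; rewrite -De; apply: (grp_additive_root addD _ eg DZ);
    exact: ec.
pose P := [pred z | (z \in Z) && (D (elt z) != 0)].
(* With [p ^ k] killing all of G, [Droot] applies to every g: were D zero on the center, it would be
   zero on G. *)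
have [z0 Pz0] : exists z, P z.
  apply/existsP; apply: contraR nzD => /existsPn E; have [k xk] := pgroup_expX.
  apply/eqP/(Droot _ k) => [|x Zx _];
    first by rewrite -rmorphXn -galg_eltX xk rmorph1.
  by apply/eqP; have := E x; rewrite /= Zx negbK.
case: (arg_minnP (fun x => #[x]%g) Pz0) => h /andP[Zh Dh] hmin.
have [n oh] : exists n, #[h]%g = (p ^ n.+1)%N.
  have [[|n] oh] := p_natP (mem_p_elt pG (in_setT h)); last by exists n.
  by case/eqP: Dh; rewrite (_ : h = 1%g) ?grp_additive1 //; apply/eqP;
    rewrite -order_eq1 oh.
have DZ x : x \in Z -> (x ^+ (p ^ n) = 1)%g -> D (elt x) = 0.
  move=> Zx xn; apply/eqP/negPn/negP=> nzx.
  have := hmin x; rewrite inE Zx nzx => /(_ isT); rewrite oh leqNgt => /negP;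
    apply.
  apply: leq_ltn_trans (_ : p ^ n < _)%N; last by rewrite ltn_exp2l ?prime_gt1.
  by rewrite dvdn_leq ?expn_gt0 ?prime_gt0 // order_dvdn xn.
have {}Droot g : e (elt g) ^+ (p ^ n) = 1 -> D (elt g) = 0.
  by move/Droot; apply.
have eM x y : e (elt (x * y)%g) = e (elt x) * e (elt y) by rewrite galg_eltM
  rmorphM.
have eV x : e (elt x^-1%g) * e (elt x) = 1 by rewrite -eM mulVg rmorph1.
have eX x k : e (elt (x ^+ k)%g) = e (elt x) ^+ k by rewrite galg_eltX rmorphXn.
(* The group G / N is abelian of exponent #[h] = p ^ n.+1, and the minimality *)
(* of #[h] implies that the image of h still has this order. Any complement   *)
(* lies in the kernel of D, since D x = 0 puts x ^+ (p ^ n) in N.             *)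
pose N := [set x | [exists w, (e (elt x) == e (elt w) ^+ (p ^ n)) && (D (elt
  w) == 0)]].
have NP x : reflect (exists w, e (elt x) = e (elt w) ^+ (p ^ n) /\ D (elt w) =
  0) (x \in N).
  rewrite inE; apply: (iffP existsP) => -[w];
    first by case/andP=> /eqP ? /eqP ?; exists w.
  by case=> ew Dw; exists w; rewrite ew Dw !eqxx.
have e1 x : e (elt x) = 1 -> x \in N.
  move=> ex; apply/NP; exists 1%g.
  by rewrite grp_additive1 // galg_elt1 rmorph1 expr1n.
have gN : group_set N.
  apply/group_setP; split=> [|x y /NP[w [ex Dw]] /NP[w' [ey Dw']]].
    by rewrite e1 // galg_elt1 rmorph1.
  apply/NP; exists (w * w')%g; rewrite addD Dw Dw' addr0; split=> //.
  by rewrite !eM exprMn_comm ?ex ?ey //; exact: ec.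
pose Ng := group gN.
have eJ x y : e (elt (x ^ y)%g) = e (elt x).
  by rewrite conjgE !eM ec -mulrA -eM mulgV galg_elt1 rmorph1 mulr1.
have nN : [set: gT] \subset 'N(Ng)%g.
  apply/subsetP=> y _; rewrite inE;
    apply/subsetP=> _ /imsetP[x /NP[w [ex Dw]] ->].
  by apply/NP; exists w; rewrite eJ.
have cN : ([set: gT]^`(1) \subset Ng)%g.
  rewrite gen_subG; apply/subsetP=> _ /imset2P[x y _ _ ->]; apply: e1.
  by rewrite commgEl eM eJ eV.
have inNN x : x \in 'N(Ng)%g by rewrite (subsetP nN) ?inE.
have ocos : #[coset Ng h]%g = #[h]%g.
  have [k lek ok] : exists2 k, (k <= n.+1)%N & #[coset Ng h]%g = (p ^ k)%N.
    by apply/(dvdn_pfactor _ _ p_pr);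
      rewrite -oh order_dvdn -morphX ?inNN //= expg_order morph1.
  rewrite ok oh; congr (_ ^ _)%N; apply/eqP; rewrite eqn_leq lek ltnNge.
  apply: contra Dh => lekn; apply/eqP.
  have: coset Ng (h ^+ (p ^ n))%g = 1%g.
    apply/eqP; rewrite morphX ?inNN //= -order_dvdn ok.
    by rewrite dvdn_exp2l.
  move/(coset_idr (inNN _))/NP=> [w [ehw Dw]].
  rewrite -(mulgKV w h) addD Dw addr0; apply: Droot.
  rewrite eM exprMn_comm; last exact: ec.
  by rewrite -eX ehw -exprMn_comm; last exact: ec;
    rewrite -eM mulgV galg_elt1 rmorph1 expr1n.
have expN x : D (elt x) = 0 -> (x ^+ (p ^ n))%g \in N.
  by move=> Dx; apply/NP; exists x; rewrite eX.
have Gh : coset Ng h \in ([set: gT] / Ng)%g by rewrite mem_quotient ?inE.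
have oexp : #[coset Ng h]%g = exponent ([set: gT] / Ng)%g.
  apply/eqP; rewrite eqn_dvd dvdn_exponent // ocos oh;
    apply/exponentP=> _ /morphimP[x _ _ ->].
  rewrite -morphX ?inNN //= coset_id // expnS expgM expN //.
  by rewrite grp_additiveX // -mulr_natr (pcharf0 (pchar_Fp p_pr)) mulr0.
have /splitsP[K /complP[tiK defK]] :=
  abelian_splits Gh oexp (sub_der1_abelian cN).
pose H := (coset Ng @*^-1 K)%G.
have HE x : (x \in H) = (coset Ng x \in K).
  by apply/morphpreP/idP => [[] //|Kx]; split=> //; apply: inNN.
have ti_h i : ((coset Ng h) ^+ i)%g \in K -> (#[h]%g %| i)%N.
  move=> Ki; rewrite -ocos order_dvdn; apply/eqP/set1gP; rewrite -tiK inE Ki.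
  by rewrite mem_cycle.
have ch x : commute h x by case/centerP: Zh => _; apply; rewrite inE.
exists h, H; split=> //.
- rewrite dprodE.
  + apply/eqP; rewrite eqEsubset subsetT; apply/subsetP=> x _.
    have: coset Ng x \in ([set: gT] / Ng)%g by rewrite mem_quotient ?inE.
    rewrite -defK => /mulsgP[_ k /cycleP[i ->] Kk xE].
    rewrite -(mulKVg (h ^+ i)%g x) mem_mulg ?mem_cycle // HE.
    by rewrite morphM ?morphV ?morphX ?inNN //= xE mulKg.
  + rewrite centsC cycle_subG; apply/centP=> x _; exact: ch.
  apply/trivgP/subsetP=> x /setIP[/cycleP[i ->]];
    rewrite HE morphX ?inNN //= => /ti_h.
  by rewrite order_dvdn inE.
(* Dividing x by [h ^+ i] gives an element of the kernel of D, whose [p ^ n]-th power lies in N.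
   Comparing [p ^ n]-th powers modulo N then forces p to divide i. *)
move=> x; rewrite HE => Kx; pose i : nat := (D (elt x) / D (elt h) : 'F_p).
have Di : D (elt x) = D (elt h) *+ i.
  by rewrite -mulr_natr natr_Zp mulrC divfK.
have Dy : D (elt (x * h ^- i)%g) = 0.
  by rewrite addD grp_additiveV // grp_additiveX // Di subrr.
have := coset_id (expN _ Dy : _ \in Ng).
have cxh : commute x (h ^- i)%g by apply/commuteV/commuteX/esym/ch.
rewrite expgMn // morphM ?inNN // expgVn morphV ?morphX ?inNN //=.
move/(canRL (mulgK _)); rewrite mul1g invgK => xh.
have: (#[h]%g %| i * p ^ n)%N by apply: ti_h; rewrite expgM -xh groupX.
rewrite oh expnS dvdn_pmul2r ?expn_gt0 ?prime_gt0 // => /dvdnP[m iE].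
by rewrite Di iE mulrnA -mulr_natr (pcharf0 (pchar_Fp p_pr)) mulr0.
Qed.
End Idempotent.
End Central.

(** * Direct factors and the group algebra of a cyclic group *)

Lemma dprod_proj (gT : finGroupType) (K H : {group gT}) :
  (K \x H = [set: gT])%g ->
  exists f g : gT -> gT,
    [/\ {morph f : x y / (x * y)%g}, {morph g : x y / (x * y)%g},
        forall x, [/\ f x \in K, g x \in H & x = (f x * g x)%g],
        forall x, x \in K -> f x = x /\ g x = 1%g
      & forall x, x \in H -> f x = 1%g /\ g x = x].
Proof.
case/dprodP=> _ defG cKH tiKH.
have cplH : H \in [complements to K in [set: gT]]%g by apply/complP.
have nsK : (K <| [set: gT])%g.
  by rewrite -defG -cent_joinEr // normalYl cents_norm.
exists (divgr K H), (remgr K H); split.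
- by move=> x y; apply: (divgrM cplH cKH); rewrite inE.
- by move=> x y; apply: (remgrM cplH nsK); rewrite inE.
- by move=> x; rewrite mem_divgr ?mem_remgr -?divgr_eq // defG inE.
- by move=> x Kx; rewrite divgr_id ?remgr1.
by move=> x Hx; have rx := remgr_id tiKH Hx; rewrite /divgr rx mulgV.
Qed.

Section Cycle.
Variables (F : fieldType) (gT : finGroupType).
Local Notation A := (galg F gT).
Local Notation elt := (galg_elt F).

Lemma gsum_cycle (h : gT) : gsum F <[h]>%g = \sum_(i < #[h]%g) elt h ^+ i.
Proof.
have -> : <[h]>%g = [set (h ^+ (i : 'I_#[h]%g))%g | i in 'I_#[h]%g].
  apply/eqP; rewrite eq_sym eqEcard; apply/andP; split.
    by apply/subsetP=> _ /imsetP[i _ ->]; apply: mem_cycle.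
  rewrite card_in_imset ?card_ord // => i j _ _ /eqP.
  by rewrite eq_expg_mod_order !modn_small // => /eqP/val_inj.
rewrite /gsum big_imset /= => [|i j _ _ /eqP]; last first.
  by rewrite eq_expg_mod_order !modn_small // => /eqP/val_inj.
by apply: eq_bigr => i _; rewrite galg_eltX.
Qed.

Lemma supported_cycle_horner (h : gT) (u : A) :
  supported <[h]>%g u -> exists P, u = horner_alg (elt h) P.
Proof.
move=> hu; rewrite (supportedE hu).
apply: (big_ind (fun v => exists P, v = horner_alg (elt h) P)) =>
  [|v w [P ->] [Q ->]|x].
- by exists 0; rewrite raddf0.
- by exists (P + Q); rewrite raddfD.
case/cycleP=> i ->; exists (u (h ^+ i)%g *: 'X^i).
by rewrite linearZ /= rmorphXn /= horner_algX galg_eltX mulr_algl.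
Qed.

Lemma aug_horner_alg (h : gT) (P : {poly F}) :
  aug F gT (horner_alg (elt h) P) = P.[1].
Proof.
elim/poly_ind: P => [|P c IH]; first by rewrite !raddf0 horner0.
rewrite [horner_alg _ _]rmorphD rmorphM /= horner_algX horner_algC.
rewrite rmorphD rmorphM /= IH aug_elt linearZ /= rmorph1.
by rewrite !hornerE [_ *: _]mulr1.
Qed.

End Cycle.

(** * The automorphism that replaces h by e h *)

Section ShiftAutomorphism.
Variables (p : nat) (gT : finGroupType).
Hypotheses (p_pr : prime p) (pG : (p.-group [set: gT])%g).
Local Notation A := (galg 'F_p gT).
Local Notation elt := (galg_elt 'F_p).

Lemma bijective_lrmorphism (f : {lrmorphism A -> A}) :
  injective f -> exists g : {lrmorphism A -> A}, cancel f g /\ cancel g f.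
Proof.
move=> f_inj; have K0 : lker (linfun f) == 0%VS.
  by apply/lker0P=> u v; rewrite !lfunE; apply: f_inj.
pose g := (linfun f)^-1%VF.
have fK : cancel f g by move=> u; have := lker0_lfunK K0 u; rewrite lfunE.
have gK : cancel g f by move=> u; have := lker0_lfunVK K0 u; rewrite lfunE.
by exists (lrmorphism_of (can2_linear fK gK) (can2_monoid_morphism fK gK)).
Qed.

(* One has y - 1 = t (h - 1), and D y = D h implies aug t = 1, so t ^+ #[h] = *)
(* 1 and t (y - 1) ^+ #[h].-1 = (h - 1) ^+ #[h].-1 is the sum of <[h]>.       *)
Lemma shift_unit (h : gT) (y : A) (D : {linear A -> ('F_p)^o}) :
  supported <[h]>%g y -> aug _ _ y = 1 -> grp_additive D ->
  D y = D (elt h) -> D (elt h) != 0 -> (y - 1) ^+ (#[h]%g).-1 != 0.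
Proof.
move=> hy y1 addD Dy nzDh; have [k oh] := p_natP (mem_p_elt pG (in_setT h)).
have pchP : p \in [pchar {poly 'F_p}] by rewrite pchar_poly pchar_Fp.
have [P yP] := supported_cycle_horner hy.
pose ev : {rmorphism {poly 'F_p} -> A} := horner_alg (elt h).
have P1 : root (P - 1) 1 by rewrite rootE !hornerE -(@aug_horner_alg _ gT h)
  -yP y1 subrr.
have [Q PQ] := factor_theorem _ _ P1.
have yev : y = ev P by [].
have augev R : aug _ _ (ev R) = R.[1] by apply: aug_horner_alg.
have evX : ev 'X = elt h by apply: horner_algX.
have evX1 : ev ('X - 1%:P) = elt h - 1 by rewrite rmorphB rmorph1 evX.
have DM t : D (t * (elt h - 1)) = D (elt h) * aug _ _ t.
  rewrite augE mulr_sumr {1}[t]galg_decomp mulr_suml linear_sum.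
  apply: eq_bigr => x _; rewrite -scalerAl linearZ /= mulrBr mulr1 -galg_eltM.
  by rewrite linearB /= addD addrAC subrr add0r mulrC.
have yE : y - 1 = ev Q * (elt h - 1) by rewrite -evX1 -rmorphM -PQ rmorphB
  rmorph1 -yev.
have Q1 : Q.[1] = 1.
  rewrite -augev; apply: (mulfI nzDh); rewrite mulr1 -DM -yE.
  by rewrite linearB /= -galg_elt1 (grp_additive1 addD) subr0.
have rQ1 : root (Q - 1) 1 by rewrite rootE !hornerE Q1 subrr.
have [Q' QQ'] := factor_theorem _ _ rQ1.
have hp : elt h ^+ (p ^ k) = 1 by rewrite -galg_eltX -oh expg_order.
have hq : ev (('X - 1%:P) ^+ (p ^ k)) = 0.
  rewrite (exprB1_pchar pchP) rmorphB rmorph1 rmorphXn evX.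
  by apply/eqP; rewrite subr_eq0; apply/eqP.
have evQ : ev (Q ^+ (p ^ k)) = 1.
  apply/eqP; rewrite -subr_eq0 -(rmorph1 ev) -rmorphB -(exprB1_pchar pchP).
  by rewrite QQ' exprMn rmorphM hq mulr0.
have q_gt0 : (0 < p ^ k)%N by rewrite expn_gt0 prime_gt0.
have QX : Q ^+ (p ^ k) * ('X - 1%:P) ^+ (p ^ k).-1 = (Q * ('X - 1%:P)) ^+ (p ^
  k).-1 * Q.
  by rewrite exprMn -{1}(prednK q_gt0) exprSr mulrAC.
rewrite oh; apply/eqP=> y0; have: gsum 'F_p <[h]>%g = 0.
  rewrite gsum_cycle oh sum_expr_pchar // -evX1 -rmorphXn -[LHS]mul1r -evQ.
  by rewrite -rmorphM QX rmorphM rmorphXn rmorphM evX1 -yE y0 mul0r.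
move/ffunP/(_ 1%g)/eqP; rewrite gsumE group1 ffunE oner_eq0 //.
Qed.

(** The map exists because e h is central. By [galg_hom_inj] it is injective once the image of the
    sum of G is nonzero; this image is [(e h - 1) ^+ (#[h]).-1] times the sum of H, which
    [shift_unit] controls. *)
Lemma shift_automorphism (e : {lrmorphism A -> A}) (D : {linear A -> ('F_p)^o})
    (h : gT) (H : {group gT}) :
  (forall u v, e u * v = v * e u) -> (<[h]> \x H = [set: gT])%g ->
  grp_additive D -> (forall u, D (e u) = D u) -> D (elt h) != 0 ->
  (forall x, x \in H -> D (elt x) = 0) ->
  exists alpha beta : {lrmorphism A -> A},
    [/\ cancel alpha beta, cancel beta alpha, alpha (elt h) = e (elt h)
      & forall x, x \in H -> alpha (elt x) = elt x].
Proof.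
move=> ec dG addD De nzDh DH; have [_ _ _ tiH] := dprodP dG.
have [f [g [fM gM fg fh gH]]] := dprod_proj dG.
pose a x := e (elt (f x)) * elt (g x).
have a1 : a 1%g = 1.
  by rewrite /a; have [-> ->] := gH _ (group1 H);
    rewrite galg_elt1 rmorph1 mulr1.
have aM : {morph a : x y / (x * y)%g >-> x * y}.
  move=> x y; rewrite /a fM gM !galg_eltM rmorphM /= [LHS]mulrA -[in
    LHS](mulrA (e (elt (f x)))).
  by rewrite (ec (elt (f y)) (elt (g x))) mulrA -mulrA.
have f1 : elt (f 1%g) = 1 by have [-> _] := gH _ (group1 H); rewrite galg_elt1.
have rhoM : {morph (fun x => elt (f x)) : x y / (x * y)%g >-> x * y}.
  by move=> x y; rewrite fM galg_eltM.
pose alpha := galg_hom a1 aM; pose rho := galg_hom f1 rhoM.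
have ah : alpha (elt h) = e (elt h).
  by rewrite galg_homE /a; have [-> ->] := fh _ (cycle_id h);
    rewrite galg_elt1 mulr1.
have aH x : x \in H -> alpha (elt x) = elt x.
  by move=> Hx; rewrite galg_homE /a; have [-> ->] := gH _ Hx;
    rewrite galg_elt1 rmorph1 mul1r.
have rho_supp u : supported <[h]>%g (rho u).
  rewrite (galg_linearE rho); apply: supported_sum => x _; apply: supportedZ.
  by rewrite /= galg_homE; apply: supported_elt; case: (fg x).
(* The sum of H absorbs elements of H, so that e h, which need not be supported on [<[h]>], can be
   replaced by [rho (e h)]. *)
have rho_gsum u : rho u * gsum _ H = u * gsum _ H.
  rewrite (galg_linearE rho) {2}[u]galg_decomp !mulr_suml;
    apply: eq_bigr => x _.
  rewrite -!scalerAl /= galg_homE; congr (_ *: _).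
  have [_ Hg xE] := fg x; rewrite [in RHS]xE galg_eltM -mulrA; congr (_ * _).
  apply/ffunP=> y; rewrite galg_mul_eltl !gsumE.
  by rewrite groupMl // groupV.
have Drho u : D (rho u) = D u.
  apply: (galg_linear_ext (f := D \o rho)) => x /=; rewrite galg_homE.
  by have [_ Hg xE] := fg x; rewrite [in RHS]xE addD (DH _ Hg) addr0.
have nza : alpha (gsum _ [set: gT]) != 0.
  have [k oh] := p_natP (mem_p_elt pG (in_setT h)).
  rewrite -(gsum_dprod _ dG) rmorphM /=.
  have -> : alpha (gsum _ H) = gsum _ H.
    by rewrite linear_sum; apply: eq_bigr => x Hx; apply: aH.
  rewrite gsum_cycle oh sum_expr_pchar // rmorphXn rmorphB rmorph1 /= ah.
  rewrite -rho_gsum rmorphXn rmorphB rmorph1 /=.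
  have : (rho (e (elt h)) - 1) ^+ (#[h]%g).-1 != 0.
    apply: (shift_unit (D := D)) => //; last by rewrite Drho De.
    by rewrite [LHS](aug_unique p_pr pG (aug _ _ \o (rho \o e))) aug_elt.
  rewrite oh; apply: contra => /eqP E; apply/eqP/ffunP=> x.
  have hy : supported <[h]>%g ((rho (e (elt h)) - 1) ^+ (p ^ k).-1).
    apply: supportedX; apply: supportedD => //; apply: supportedN;
      exact: supported1.
  have [hx|nhx] := boolP (x \in <[h]>%g); last by rewrite hy // ffunE.
  have := galg_mul_dprod tiH hy (@supported_gsum 'F_p gT H) hx (group1 H).
  by rewrite E gsumE group1 mulg1 mulr1 => <-.
have [beta [ab ba]] := bijective_lrmorphism (galg_hom_inj p_pr pG nza).
by exists alpha, beta.
Qed.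
End ShiftAutomorphism.

(** * Group algebra maps induced by injective group morphisms *)

Section Embedding.
Variables (F : fieldType) (rT gT : finGroupType) (t : rT -> gT).
Hypotheses (tM : {morph t : x y / (x * y)%g}) (t_inj : injective t).
Local Notation elt := (galg_elt F).

Fact galg_map1 : elt (t 1%g) = 1.
Proof.
by rewrite -galg_elt1; congr elt; apply: (mulgI (t 1%g)); rewrite -tM !mulg1.
Qed.

Fact galg_mapM : {morph (fun x => elt (t x)) : x y / (x * y)%g >-> x * y}.
Proof. by move=> x y; rewrite tM galg_eltM. Qed.

Definition galg_map : {lrmorphism galg F rT -> galg F gT} :=
  galg_hom galg_map1 galg_mapM.

Lemma galg_map_elt x : galg_map (elt x) = elt (t x).
Proof. exact: galg_homE. Qed.

Lemma galg_mapE v x : galg_map v (t x) = v x.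
Proof.
rewrite (galg_linearE galg_map) sum_ffunE (bigD1 x) //= big1 => [|y nyx].
  by rewrite galg_map_elt !ffunE eqxx [_ *: _]mulr1 addr0.
by rewrite galg_map_elt !ffunE (inj_eq t_inj) (negPf nyx) scaler0.
Qed.

Lemma supported_map (Q : {set rT}) v :
  supported Q v -> supported (t @: Q) (galg_map v).
Proof.
move=> Qv; rewrite (supportedE Qv) linear_sum; apply: supported_sum => x Qx.
rewrite linearZ /= galg_map_elt; apply/supportedZ/supported_elt.
exact: imset_f.
Qed.

Lemma galg_map_gsum (Q : {set rT}) :
  galg_map (gsum F Q) = gsum F (t @: Q).
Proof.
rewrite /gsum linear_sum big_imset /=; last by move=> x y _ _ /t_inj.
by apply: eq_bigr => x _; rewrite galg_map_elt.
Qed.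

Lemma galg_map_inv u :
  supported (t @: [set: rT]) u -> exists v, galg_map v = u.
Proof.
move=> Tu; exists [ffun x => u (t x)]; apply/ffunP=> y.
have [/imsetP[x _ ->]|Ty] := boolP (y \in t @: [set: rT]).
  by rewrite galg_mapE ffunE.
by rewrite Tu // (supported_map (Q := [set: rT])) // => x; rewrite inE.
Qed.

End Embedding.

(** * Reduction from G to the complement H *)

Section TensorPair.
Variable p : nat.
Hypothesis p_pr : prime p.

(* The maps e : b c |-> aug(c) b and c : b c |-> aug(b) c for A = B (x) C     *)
(* with B central.                                                            *)
Definition tensor_pair (gT : finGroupType) (e c : galg 'F_p gT ->
  galg 'F_p gT) :=
  [/\ forall u, e (e u) = e u, forall u v, e u * v = v * e u,
      forall u, c (c u) = c u, forall u, c (e u) = (aug 'F_p gT u : 'F_p) *: 1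
    & forall u, exists s : seq (galg 'F_p gT * galg 'F_p gT),
        u = \sum_(i <- s) e i.1 * c i.2].

(* For an algebra endomorphism f, this says that f maps F_p Q bijectively     *)
(* onto the image of f: the first condition is injectivity, by galg_hom_inj.  *)
Definition realizes (gT : finGroupType) (f : galg 'F_p gT -> galg 'F_p gT)
    (Q : {set gT}) :=
  f (gsum _ Q) != 0 /\ forall u, exists2 v, supported Q v & f u = f v.

Definition realizable (gT : finGroupType) (e c : galg 'F_p gT ->
  galg 'F_p gT) :=
  exists Q R : {group gT}, [/\ (Q \x R = [set: gT])%g,
    realizes e Q & realizes c R].

(** Here e is the augmentation, so the spanning condition makes every element a combination of
    values of c; c being idempotent, it is the identity. *)
Lemma realizable_trivial (gT : finGroupType) (e c : {lrmorphism galg 'F_p gT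
  -> galg 'F_p gT}) :
  tensor_pair e c -> (forall x, e (galg_elt _ x) = 1) -> realizable e c.
Proof.
case=> _ _ cc _ span e1.
have eE u : e u = (aug 'F_p gT u : 'F_p) *: 1.
  rewrite (galg_linearE e) augE scaler_suml; apply: eq_bigr => x _.
  by rewrite /= e1.
have cE u : c u = u.
  have [s ->] := span u; rewrite linear_sum; apply: eq_bigr => i _.
  by rewrite /= eE -scalerAl mul1r linearZ /= cc.
have gsum1 : gsum 'F_p [set 1%g : gT] = 1 by rewrite /gsum big_set1.
exists 1%G, [set: gT]%G; split; first by rewrite dprod1g.
  split=> [|u]; first by rewrite gsum1 rmorph1 oner_eq0.
  exists ((aug 'F_p gT u : 'F_p) *: 1);
    first exact/supportedZ/(@supported1 _ gT 1%G).
  by rewrite linearZ /= rmorph1 eE.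
split=> [|u]; last by exists u => // x; rewrite inE.
rewrite cE; apply/eqP=> /ffunP/(_ 1%g)/eqP.
by rewrite gsumE inE ffunE oner_eq0.
Qed.

Variables (gT : finGroupType) (h : gT) (H : {group gT}).
Hypotheses (pG : (p.-group [set: gT])%g) (dG : (<[h]> \x H = [set: gT])%g).
Local Notation A := (galg 'F_p gT).
Local Notation AH := (galg 'F_p (subg_of H)).
Local Notation elt := (galg_elt 'F_p).

Let sgvM : {morph (@sgval _ H) : x y / (x * y)%g}. Proof. by []. Qed.
Local Notation incl := (galg_map 'F_p sgvM).

(** [psi] is the quotient map by (h - 1) A; its kernel is that ideal because h - 1 divides every
    [h ^+ i - 1]. *)
Lemma galg_retraction :
  exists psi : {lrmorphism A -> AH},
    [/\ forall v, psi (incl v) = v, psi (elt h) = 1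
      & forall u, exists v, u = incl (psi u) + (elt h - 1) * v].
Proof.
have [f [g [_ gM fg fh gH]]] := dprod_proj dG.
pose q x : AH := elt (subg H (g x)).
have gin x : g x \in H by case: (fg x).
have q1 : q 1%g = 1.
  have [_ g1] := gH _ (group1 H).
  by rewrite /q g1 -galg_elt1; congr elt; apply: val_inj; rewrite /= subgK.
have qM : {morph q : x y / (x * y)%g >-> x * y}.
  by move=> x y; rewrite /q gM subgM // galg_eltM.
exists (galg_hom q1 qM); split.
- move=> v; apply: (galg_linear_ext (f := galg_hom q1 qM \o incl) (g := idfun)).
  move=> x /=; rewrite galg_map_elt galg_homE /q.
  by have [_ ->] := gH _ (subgP x); rewrite sgvalK.
- by rewrite galg_homE /q; have [_ ->] := fh _ (cycle_id h); rewrite -q1 /q;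
  have [_ ->] := gH _ (group1 H).
move=> u; rewrite {1 2}[u]galg_decomp !linear_sum.
apply: (big_ind2 (fun a b => exists v, a = b + (elt h - 1) * v)).
- by exists 0; rewrite mulr0 addr0.
- move=> a b a' b' [v ->] [w ->]; exists (v + w).
  by rewrite mulrDr addrACA.
move=> x _; rewrite !linearZ /= galg_homE galg_map_elt subgK //.
have [/cycleP[i fx] _ xE] := fg x.
have -> : elt x = elt h ^+ i * elt (g x) by rewrite {1}xE fx galg_eltM
  galg_eltX.
exists ((u x : 'F_p) *: (\sum_(j < i) elt h ^+ j * elt (g x))).
rewrite -scalerAr -scalerDr -mulr_suml mulrA -subrX1.
by rewrite mulrBl mul1r addrC subrK.
Qed.

(** As e commutes with multiplication by h - 1 and c kills (h - 1) A, both induce maps on F_p H. A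
    factorization [Q1], [R1] for these gives Q = <[h]> x [Q1] and R = [R1]. *)
Lemma cycle_step (e c : {lrmorphism A -> A}) :
  tensor_pair e c -> e (elt h) = elt h -> c (elt h) = 1 ->
  (forall e1 c1 : {lrmorphism AH -> AH}, tensor_pair e1 c1 ->
    realizable e1 c1) ->
  exists Q R : {group gT},
    [/\ (Q \x R = [set: gT])%g, R \subset H, realizes e Q & realizes c R].
Proof.
case=> ee ec cc ce span eh ch IH.
have [psi [psiK psih dec]] := galg_retraction.
have eh1 u : e ((elt h - 1) * u) = (elt h - 1) * e u.
  by rewrite rmorphM rmorphB rmorph1 /= eh.
have ch1 u : c ((elt h - 1) * u) = 0.
  by rewrite rmorphM rmorphB rmorph1 /= ch subrr mul0r.
have psih1 u : psi ((elt h - 1) * u) = 0.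
  by rewrite rmorphM rmorphB rmorph1 /= psih subrr mul0r.
have psie u : psi (e (incl (psi u))) = psi (e u).
  by have [v {2}->] := dec u; rewrite 2!raddfD /= eh1 psih1 addr0.
have cpsi u : c (incl (psi u)) = c u.
  by have [v {2}->] := dec u; rewrite raddfD /= ch1 addr0.
pose e1 : {lrmorphism AH -> AH} := psi \o (e \o incl).
pose c1 : {lrmorphism AH -> AH} := psi \o (c \o incl).
have /IH[Q1 [R1 [dQR [nzQ surjQ] [nzR surjR]]]] : tensor_pair e1 c1.
  split=> [u|u v|u|u|u] /=.
  - by rewrite psie ee.
  - by rewrite -{1}(psiK v) -{2}(psiK v) -!rmorphM /= ec.
  - by rewrite cpsi cc.
  - rewrite cpsi ce linearZ /= rmorph1; congr (_ *: _).
    apply: (galg_linear_ext (f := aug _ _ \o incl)) => x /=.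
    by rewrite galg_map_elt !aug_elt.
  have [s us] := span (incl u).
  exists [seq (psi i.1, psi i.2) | i <- s].
  rewrite -{1}(psiK u) us linear_sum big_map; apply: eq_bigr => i _.
  by rewrite /= rmorphM /= psie cpsi.
pose Q2 := (sgval @* Q1)%G; pose R := (sgval @* R1)%G.
have Q2E : sgval @: Q1 = Q2 by rewrite /= morphimEsub ?subsetT.
have RE : sgval @: R1 = R by rewrite /= morphimEsub ?subsetT.
have dH : (Q2 \x R = H)%g.
  rewrite /= (injm_dprod (subxx _) (injm_sgval H) dQR).
  exact: im_sgval.
have [sQ2H sRH] : Q2 \subset H /\ R \subset H.
  by have [_ <- _ _] := dprodP dH; rewrite mulG_subl mulG_subr.
have dQG := dG; rewrite -dH dprodA in dQG.
have [[Q _ defQ _] _ _ _] := dprodP dQG; rewrite defQ in dQG.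
have [sQ2Q hQ] : Q2 \subset Q /\ h \in Q.
  have [_ <- _ _] := dprodP defQ; split; first exact: mulG_subr.
  by apply: (subsetP (mulG_subl _ _)); apply: cycle_id.
have inclH v : supported H (incl v).
  have sTH : sgval @: [set: subg_of H] \subset H.
    by apply/subsetP=> _ /imsetP[x _ ->]; apply: subgP.
  by apply: supportedS sTH _; apply: supported_map => x; rewrite inE.
have inclQ v : supported Q1 v -> supported Q (incl v).
  by move=> Qv; apply: (supportedS sQ2Q); rewrite -Q2E; apply: supported_map.
have inclR v : supported R1 v -> supported R (incl v).
  by move=> Rv; rewrite -RE; apply: supported_map.
have hQ1 : supported Q (elt h - 1).
  by apply: supportedD; [apply: supported_elt|apply/supportedN/supported1].
exists Q, R; split=> //.
  split.
    have gsumh : gsum 'F_p <[h]>%g * (elt h - 1) = 0.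
      rewrite mulrBr mulr1; apply/eqP; rewrite subr_eq0; apply/eqP/ffunP=> x.
      by rewrite galg_mul_eltr !gsumE groupMr // groupV cycle_id.
    rewrite -(gsum_dprod _ defQ) rmorphM /=.
    have -> : e (gsum _ <[h]>%g) = gsum _ <[h]>%g.
      rewrite gsum_cycle linear_sum; apply: eq_bigr => i _.
      by rewrite rmorphXn /= eh.
    (* The sum of [<[h]>] kills (h - 1) A, so only the component in F_p H matters; its coefficients
       can be read off in the direct product. *)
    have [v ->] := dec (e (gsum _ Q2)).
    rewrite mulrDr mulrA gsumh mul0r addr0 -Q2E -(galg_map_gsum 'F_p sgvM);
      last exact: val_inj.
    apply: contra nzQ => /eqP E; apply/eqP/ffunP=> x.
    have [_ _ _ tiH] := dprodP dG.
    pose y := psi (e (incl (gsum 'F_p Q1))).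
    have := galg_mul_dprod tiH (@supported_gsum _ _ _) (inclH y) (group1 _)
      (subgP x).
    rewrite E gsumE group1 mul1r (galg_mapE sgvM (@subg_inj _ H)) => <-.
    by rewrite !ffunE.
  move=> u; have [k oh] := p_natP (mem_p_elt pG (in_setT h)).
  (* Successive approximation: [surjQ] solves the problem modulo h - 1, and the error is again h - 1
     times a value of e. The process stops because h - 1 is nilpotent. *)
  have step n : exists v w, supported Q v /\ e u = e v + (elt h - 1) ^+ n * e w.
    elim: n => [|n [v [w [Qv ->]]]].
      by exists 0, u; split; [exact: supported0|rewrite raddf0 add0r mul1r].
    have [v1 Qv1 ewv1] := surjQ (psi w).
    have [w' E] := dec (e w - e (incl v1)).
    have psi0 : psi (e w - e (incl v1)) = 0.
      by rewrite raddfB /= -psie -[psi (e (incl v1))]ewv1 subrr.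
    exists (v + (elt h - 1) ^+ n * incl v1), w'; split.
      by apply: supportedD => //; apply: supportedM;
        [apply: supportedX|apply: inclQ].
    have hX a : e ((elt h - 1) ^+ n * a) = (elt h - 1) ^+ n * e a.
      by rewrite rmorphM rmorphXn rmorphB rmorph1 /= eh.
    have -> : e w = e (incl v1) + (elt h - 1) * e w'.
      rewrite -eh1; move: E; rewrite psi0 rmorph0 add0r => E.
      by rewrite -E raddfB /= !ee addrC subrK.
    by rewrite raddfD /= hX mulrDr addrA mulrA -exprSr.
  have [v [w [Qv ->]]] := step (p ^ k)%N; exists v => //.
  rewrite (exprB1_pchar (pchar_galg gT p_pr)) -galg_eltX -oh expg_order.
  by rewrite galg_elt1 subrr mul0r addr0.
split.
  apply: contra nzR => /eqP E.
  rewrite /= -RE -(galg_map_gsum 'F_p sgvM) in E; last exact: val_inj.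
  by rewrite /= E rmorph0.
move=> u; have [v1 Rv1 cv1] := surjR (psi u).
exists (incl v1); first exact: inclR.
(* The difference lies in (h - 1) A, which c kills; as c is idempotent, it is zero. *)
have [w] := dec (c u - c (incl v1)).
have -> : psi (c u - c (incl v1)) = 0.
  by rewrite raddfB /= -cpsi -[psi (c (incl v1))]cv1 subrr.
rewrite rmorph0 add0r => /(congr1 c); rewrite ch1 raddfB /= !cc => /eqP.
by rewrite subr_eq0 => /eqP.
Qed.
End TensorPair.

(** * The induction on the order of the group *)

Lemma pgroup_subg p (gT : finGroupType) (G : {group gT}) :
  (p.-group G -> p.-group [set: subg_of G])%g.
Proof. by move=> pG; rewrite /pgroup -(card_injm (injm_sgval G)) ?subsetT //
  im_sgval. Qed.

Lemma tensor_pair_realizable p (gT : finGroupType)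
    (e c : {lrmorphism galg 'F_p gT -> galg 'F_p gT}) :
  prime p -> (p.-group [set: gT])%g -> tensor_pair e c -> realizable e c.
Proof.
move=> p_pr; have [n] := ubnP #|[set: gT]|.
elim: n gT e c => // n IHn gT e c /ltnSE leGn pG tp.
have [/forallP triv | ntriv] := boolP [forall x, e (galg_elt _ x) == 1].
  by apply: realizable_trivial => // x; apply/eqP.
have [x0 ntx0] : exists x, e (galg_elt _ x) != 1 by apply/existsP;
  rewrite -negb_forall.
have [ee ec cc ce span] := tp.
have [D [addD De [x nzDx]]] := idempotent_additive p_pr pG ee ntx0.
have [h [H [dG nzDh DH]]] := split_cyclic p_pr pG ec addD De nzDx.
have [alpha [beta [ab ba ah aH]]] :=
  shift_automorphism p_pr pG ec dG addD De nzDh DH.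
have ea u : e (alpha u) = e u.
  apply: (galg_linear_ext (f := e \o alpha)) => y /=.
  have [_ defG _ _] := dprodP dG.
  have /mulsgP[_ r /cycleP[i ->] Hr ->] : y \in (<[h]> * H)%g by rewrite defG
    inE.
  by rewrite !galg_eltM !rmorphM /= (aH r) // galg_eltX !rmorphXn /= ah ee.
(* Both are conjugates by [alpha]; for e the inner [alpha] is absorbed by [ea]. *)
pose e' : {lrmorphism galg 'F_p gT -> galg 'F_p gT} := beta \o e.
pose c' : {lrmorphism galg 'F_p gT -> galg 'F_p gT} := beta \o (c \o alpha).
have eb u : e (beta u) = e u by rewrite -ea ba.
have tp' : tensor_pair e' c'.
  split=> [u|u v|u|u|u] /=.
  - by rewrite eb ee.
  - by rewrite -[v]ab -!rmorphM /= ec.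
  - by rewrite ba cc.
  - by rewrite ba ce linearZ /= rmorph1.
  have [s us] := span (alpha u); exists [seq (i.1, beta i.2) | i <- s].
  rewrite -{1}[u]ab us linear_sum big_map; apply: eq_bigr => i _.
  by rewrite /= rmorphM /= ba.
have eh' : e' (galg_elt _ h) = galg_elt _ h by rewrite /= -ah ab.
have ch' : c' (galg_elt _ h) = 1.
  by rewrite /= ah ce aug_elt scale1r rmorph1.
have ltHn : (#|[set: subg_of H]| < n)%N.
  rewrite -(card_injm (injm_sgval H)) ?subsetT // im_sgval.
  apply: leq_trans leGn; rewrite -(dprod_card dG) ltn_Pmull ?cardG_gt0 //.
  rewrite order_gt1; apply: contra nzDh => /eqP ->.
  by rewrite (grp_additive1 addD).
have pH : (p.-group [set: subg_of H])%g by apply/pgroup_subg/(pgroupS (subsetT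
  H) pG).
have IH e1 c1 := IHn _ e1 c1 ltHn pH.
have [Q [R [dQR sRH [nzQ surQ] [nzR surR]]]] :=
  cycle_step p_pr pG dG tp' eh' ch' IH.
(* Since [alpha] fixes F_p H, on F_p R the maps [c'] and c differ only by the injective [beta]. *)
have aR v : supported R v -> alpha v = v.
  move=> Rv; rewrite {1}(supportedE Rv) [RHS](supportedE Rv) linear_sum.
  by apply: eq_bigr => y Ry; rewrite linearZ /= aH // (subsetP sRH).
exists Q, R; split=> //.
  split=> [|u]; first by apply: contra nzQ => /eqP E; rewrite /= E rmorph0.
  by have [v Qv /= /(can_inj ba)] := surQ u; exists v.
split=> [|u].
  by apply: contra nzR => /eqP E; rewrite /= aR ?E ?rmorph0 //;
    apply: supported_gsum.
have [v Rv /= /(can_inj ba)] := surR (beta u).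
by rewrite ba (aR v Rv); exists v.
Qed.

Lemma injective_surjective_bijective (T : choiceType) (T' : eqType) (f : T ->
  T') :
  injective f -> (forall y, exists x, f x = y) -> bijective f.
Proof.
move=> f_inj f_surj.
have s y : exists x, f x == y by have [x <-] := f_surj y; exists x.
have gK y : f (xchoose (s y)) = y by apply/eqP; apply: (xchooseP (s y)).
by exists (fun y => xchoose (s y)) => // x; apply: f_inj; rewrite gK.
Qed.

(** The isomorphism is f restricted to F_p Q: injective by [galg_hom_inj], onto because f is a
    retraction onto X with all its values already taken on F_p Q. *)
Lemma realizes_isomorphic p (gT : finGroupType) (G : {group gT})
    (X : {aspace (group_algebra 'F_p G)})
    (f : {lrmorphism group_algebra 'F_p G -> group_algebra 'F_p G})
    (Q : {group subg_of G}) :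
  prime p -> (p.-group G)%g -> unital_subalg X ->
  (forall u, f u \in X) -> (forall u, u \in X -> f u = u) -> realizes f Q ->
  alg_isomorphic (group_algebra 'F_p (sgval @* Q)%G) (subvs_of X).
Proof.
move=> p_pr pG X1 fX fid [nzQ surQ].
(* Q consists of elements of [subg_of G], whereas the factor sought is a subgroup of [gT]; [t]
   identifies the two. *)
pose t (x : subg_of (sgval @* Q)%G) : subg_of G := subg G (sgval x).
have sQG : (sgval @* Q \subset G)%g.
  by apply/subsetP=> _ /morphimP[x _ _ ->]; apply: subgP.
have tE x : sgval (t x) = sgval x.
  by rewrite /t subgK // (subsetP sQG) // (subgP x).
have tM : {morph t : x y / (x * y)%g}.
  by move=> x y; apply: val_inj; rewrite /= !tE.
have t_inj : injective t.
  by move=> x y /(congr1 sgval); rewrite !tE => /val_inj.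
have tQ : t @: setT = Q.
  apply/setP=> x; apply/imsetP/idP=> [[y _ ->]|Qx].
    have /morphimP[z _ Qz yE] := subgP y.
    by rewrite (_ : t y = z) //; apply: val_inj; rewrite /= tE.
  have Qx' : sgval x \in (sgval @* Q)%G by rewrite mem_morphim ?inE.
  by exists (subg _ (sgval x)); rewrite ?inE //; apply: val_inj;
    rewrite /= tE subgK.
pose phi v : subvs_of X := vsproj X (f (galg_map 'F_p tM v)).
have phiE v : vsval (phi v) = f (galg_map 'F_p tM v) by rewrite vsprojK.
have phi_lin : linear phi by move=> a u v; rewrite /phi !linearP.
have phi_mon : monoid_morphism phi.
  split=> [|u v]; apply: val_inj; rewrite [LHS]phiE.
    by rewrite !rmorph1; apply/esym/(unital_subalg_one X1).
  by rewrite !rmorphM /= -!phiE.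
pose phi' := lrmorphism_of phi_lin phi_mon.
exists phi; split=> //; apply: injective_surjective_bijective.
  apply: (galg_hom_inj (f := phi')) => //.
    by apply/pgroup_subg/(pgroupS sQG).
  apply: contra nzQ => /eqP/(congr1 vsval);
    rewrite [LHS]phiE galg_map_gsum // tQ => ->.
  by [].
move=> y; have [v Qv fv] := surQ (vsval y).
have [w wv] : exists w, galg_map 'F_p tM w = v by apply: galg_map_inv;
  rewrite ?tQ.
by exists w; apply: val_inj; rewrite /= phiE wv -fv fid // subvsP.
Qed.

(** * From the tensor factorization to a pair of retractions *)

Section TensorLift.
Variables (K : fieldType) (B C : falgType K) (A : algType K).
Variables (f : {linear B -> A}) (g : {linear C -> A}).

Lemma tlift_mulE b c :
  tlift (fun b c => f b * g c) (tens b c) = f b * g c.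
Proof.
rewrite tlift_tens // => [c0|b0] a x y; rewrite linearP.
  by rewrite mulrDl scalerAl.
by rewrite mulrDr scalerAr.
Qed.

Lemma tlift_mul_monoid_morphism :
  monoid_morphism f -> monoid_morphism g ->
  (forall b c, f b * g c = g c * f b) ->
  monoid_morphism (tlift (fun b c => f b * g c) : tensor B C -> A).
Proof.
move=> [f1 fM] [g1 gM] fg; split=> [|s t].
  by rewrite [LHS]tlift_mulE f1 g1 mulr1.
elim/tensor_ind: s => [|s s' IH IH'|b c].
- by rewrite mul0r linear0 mul0r.
- by rewrite mulrDl !linearD /= mulrDl IH IH'.
elim/tensor_ind: t => [|t t' IH IH'|b' c'].
- by rewrite mulr0 linear0 mulr0.
- by rewrite mulrDr !linearD /= mulrDr IH IH'.
rewrite [_ * _]tensor_mul_tens !tlift_mulE fM gM -!mulrA; congr (_ * _).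
by rewrite mulrA fg -mulrA.
Qed.

End TensorLift.

Lemma internal_tensor_ind (K : fieldType) (A : falgType K) (B C : {aspace A})
    (P : A -> Prop) :
  internal_tensor B C -> P 0 -> (forall u v, P u -> P v -> P (u + v)) ->
  (forall x y, x \in B -> y \in C -> P (x * y)) -> forall u, P u.
Proof.
case=> _ [mu_lin _ [nu _ nuK]] P0 PD PM u; rewrite -[u]nuK.
elim/tensor_ind: (nu u) => [|s t Ps Pt|x y].
- by rewrite /tensor_mulmap linear0.
- by rewrite /tensor_mulmap linearD; apply: PD.
by rewrite tensor_mulmap_tens; apply: PM; apply: subvsP.
Qed.

Section Projections.
Variables (K : fieldType) (A : falgType K) (B C : {aspace A}).
Variable eps : {lrmorphism A -> K^o}.
Hypotheses (B1 : unital_subalg B) (C1 : unital_subalg C).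
Hypothesis BC : internal_tensor B C.

(** These are id (x) eps and eps (x) id composed with the inverse of the multiplication map; they
    are multiplicative because scalars commute with everything. *)
Lemma internal_tensor_projections :
  exists e c : {lrmorphism A -> A},
    {in B & C, forall x y, e (x * y) = (eps y : K) *: x}
    /\ {in B & C, forall x y, c (x * y) = (eps x : K) *: y}.
Proof.
have [_ [mu_lin mu_mon [nu muK nuK]]] := BC.
pose mu := lrmorphism_of mu_lin mu_mon.
have nu_lin : linear nu by exact: (can2_linear (f := mu)).
have nu_mon : monoid_morphism nu by exact: (can2_monoid_morphism (f := mu)).
pose sc (X : {aspace A}) (x : subvs_of X) : A := (eps (vsval x) : K) *: 1.
have sc_lin (X : {aspace A}) : linear (@sc X).
  by move=> a x y; rewrite /sc !linearP scalerDl scalerA.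
have sc_mon (X : {aspace A}) : unital_subalg X -> monoid_morphism (@sc X).
  move=> X1; split=> [|x y]; rewrite /sc.
    by rewrite unital_subalg_one // rmorph1 scale1r.
  by rewrite [vsval _]/(vsval x * vsval y) rmorphM /= -scalerAl mul1r scalerA.
have vs_mon (X : {aspace A}) :
    unital_subalg X -> monoid_morphism (vsval : subvs_of X -> A).
  by move=> X1; split=> //; apply: unital_subalg_one.
pose scl (X : {aspace A}) : {linear subvs_of X -> A} :=
  HB.pack (@sc X) (GRing.isLinear.Build _ _ _ _ _ (sc_lin X)).
have scC (X Y : {aspace A}) (x : subvs_of X) (y : subvs_of Y) :
    vsval x * sc _ y = sc _ y * vsval x.
  by rewrite /sc -scalerAr -scalerAl mulr1 mul1r.
pose eT := tlift_mul_monoid_morphism (f := vsval) (g := scl C)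
  (vs_mon B B1) (sc_mon C C1) (@scC B C).
pose cT := tlift_mul_monoid_morphism (f := scl B) (g := vsval)
  (sc_mon B B1) (vs_mon C C1) (fun b c => esym (@scC C B c b)).
pose nu' := lrmorphism_of nu_lin nu_mon.
have nuE x y : nu (vsval x * vsval y) = tens x y.
  by rewrite -(tensor_mulmap_tens x y) muK.
exists (lrmorphism_of (tlift_is_linear _) eT \o nu').
exists (lrmorphism_of (tlift_is_linear _) cT \o nu').
split=> x y Bx Cy; rewrite -{1}(vsprojK Bx) -{1}(vsprojK Cy) /= nuE.
  rewrite [LHS](@tlift_mulE _ _ _ _ vsval (scl C)) /=.
  by rewrite /sc !vsprojK // -scalerAr mulr1.
rewrite [LHS](@tlift_mulE _ _ _ _ (scl B) vsval) /=.
by rewrite /sc !vsprojK // -scalerAl mul1r.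
Qed.

(** All properties are checked on products x y with x in B and y in C, which generate A additively;
    centrality of the values of e combines commutativity of B with its commuting with C. *)
Lemma internal_tensor_retractions :
  {in B &, forall x y, x * y = y * x} ->
  exists e c : {lrmorphism A -> A},
    [/\ (forall u, e u \in B) /\ (forall u, u \in B -> e u = u),
        (forall u, c u \in C) /\ (forall u, u \in C -> c u = u),
        forall u v, e u * v = v * e u,
        forall u, c (e u) = (eps u : K) *: 1
      & forall u, exists s : seq (A * A), u = \sum_(i <- s) e i.1 * c i.2].
Proof.
move=> cBB; have [cBC _] := BC.
have ind P := internal_tensor_ind (P := P) BC.
have [e [c [eE cE]]] := internal_tensor_projections.
have eB x : x \in B -> e x = x.
  by move=> Bx; rewrite -{1}[x]mulr1 eE // rmorph1 scale1r.
have cC x : x \in C -> c x = x.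
  by move=> Cx; rewrite -{1}[x]mul1r cE // rmorph1 scale1r.
have e_in u : e u \in B.
  elim/ind: u => [|u v|x y Bx Cy]; first by rewrite rmorph0 mem0v.
    by rewrite rmorphD; apply: memvD.
  by rewrite eE // memvZ.
have c_in u : c u \in C.
  elim/ind: u => [|u v|x y Bx Cy]; first by rewrite rmorph0 mem0v.
    by rewrite rmorphD; apply: memvD.
  by rewrite cE // memvZ.
exists e, c; split=> // [u v|u|u].
- elim/ind: v => [|v w IH IH'|x y Bx Cy]; first by rewrite mulr0 mul0r.
    by rewrite mulrDr mulrDl IH IH'.
  by rewrite mulrA (cBB (e u) x) // -[LHS]mulrA (cBC (e u) y) // mulrA.
- elim/ind: u => [|v w IH IH'|x y Bx Cy]; first by rewrite !rmorph0 scale0r.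
    by rewrite !rmorphD /= IH IH' scalerDl.
  rewrite eE // linearZ /= -[x in c x]mulr1 cE // scalerA rmorphM.
  by rewrite [in RHS]mulrC.
elim/ind: u => [|_ _ [s ->] [s' ->]|x y Bx Cy].
- by exists [::]; rewrite big_nil.
- by exists (s ++ s'); rewrite big_cat.
by exists [:: (x, y)]; rewrite big_seq1 /= eB // cC.
Qed.

End Projections.

Theorem theorem0p2 (p : nat) (gT : finGroupType) (G : {group gT})
    (B C : {aspace (group_algebra 'F_p G)}) :
  prime p ->
  (p.-group G)%g ->
  unital_subalg B ->
  unital_subalg C ->
  internal_tensor B C ->
  {in B &, forall x y, x * y = y * x} ->
  exists calB calC : {group gT},
    [/\ (calB \x calC)%g = G,
        alg_isomorphic (group_algebra 'F_p calB) (subvs_of B)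
      & alg_isomorphic (group_algebra 'F_p calC) (subvs_of C)].
Proof.
move=> p_pr pG B1 C1 BC cBB.
have [e [c [[e_in eB] [c_in cC] ec ce span]]] :=
  internal_tensor_retractions (aug _ _) B1 C1 BC cBB.
have tp : tensor_pair e c.
  by split=> // u; [apply: eB (e_in u)|apply: cC (c_in u)].
have [Q [R [dQR reQ rcR]]] := tensor_pair_realizable p_pr (pgroup_subg pG) tp.
exists (sgval @* Q)%G, (sgval @* R)%G; split.
- by rewrite /= (injm_dprod (subxx _) (injm_sgval G) dQR); apply: im_sgval.
- exact: (realizes_isomorphic p_pr pG B1 e_in eB reQ).
exact: (realizes_isomorphic p_pr pG C1 c_in cC rcR).
Qed.
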